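(* Let $T>0$, $0<\alpha<1$, and let $c,d,\lambda>0$ be constants. Let $(p,q)$ solve \[ \begin{cases} \displaystyle p'(t)+c\,q(t)=d\int_0^t e_{\alpha,\alpha}(-\lambda(t-s)^\alpha)\,q(s)\,ds, \qquad q'(t)=p(t), \qquad t\in(0,T],\\[4pt] q(0)=u_0,\quad p(0)=u_1 . \end{cases} \] Assume $u_0=0$ and $c-d/\lambda\ge 0$. Then \[ p^2(t)+(c-d/\lambda)\,q^2(t)\le u_1^2\qquad \text{for all } t\in[0,T]. \]
   Context: The Mittag-Leffler function is $E_{\alpha,\beta}(z)=\sum_{k=0}^\infty \frac{z^k}{\Gamma(k\alpha+\beta)}$, and $e_{\alpha,\alpha}(-\lambda t^\alpha):=t^{\alpha-1}E_{\alpha,\alpha}(-\lambda t^\alpha)$ for $t>0$. *)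

(* Defs.v *)
From Stdlib Require Import Reals.
From Coquelicot Require Import Coquelicot.
Open Scope R_scope.

Definition Gamma (x : R) : R :=
  RInt_gen (fun t => Rpower t (x - 1) * exp (- t)) (at_right 0) (Rbar_locally p_infty).

Definition mittag_leffler (a b z : R) : R :=
  Series (fun k => z ^ k / Gamma (INR k * a + b)).

(* e_{a,a}(-lam t^a) := t^(a-1) E_{a,a}(-lam t^a), for t > 0. *)
Definition ml_kernel (a lam t : R) : R :=
  Rpower t (a - 1) * mittag_leffler a a (- lam * Rpower t a).

(* Main.v *)
(* Integrating by parts against g(t) = E_alpha(-lam t^alpha), whose derivative is -lam times the
   kernel, turns the equation into p' = -(c - d/lam) q - (d/lam) w with w = g * p, where * is
   convolution on [0, t]; the energy estimate then only needs \int_0^t p w >= 0, i.e. that g is of positive type.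
   The Beta integral gives g + (lam/Gamma(alpha)) t^(alpha-1) * g = 1, so that
   p = w' + (lam/Gamma(alpha)) t^(alpha-1) * w' with w(0) = 0, and
   \int p w = w^2/2 + (lam/Gamma(alpha)) \int w (t^(alpha-1) * w').
   For a nonnegative nonincreasing kernel k one has w (k * w') >= (k * (w^2)')/2 pointwise
   (Alikhanov's inequality), whose integral is (k * w^2)/2 >= 0; the singular kernel is the limit
   of the regular ones (t + eps)^(alpha-1). *)
Require Import Defs.
From Stdlib Require Import Reals Lra Classical ssreflect.
From Coquelicot Require Import Coquelicot.
Open Scope R_scope.

(** * Integration preliminaries *)

(** The kernel t^(alpha-1) is unbounded at 0, so every identity is integrated once: t^alpha takes
    its place, and convolutions stay proper integrals of continuous functions. Positivity of \int w
    (k * w') then reads \int w' (K * w') <= w (K * w') at the final time, with K a primitive of k;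
    this form contains only K and survives uniform limits of K on a compact interval, which is how
    the singular kernel is reached. To keep integrability immediate, functions are continued to the
    whole line: powers by 0, g by 1, p and q by their boundary values; derivatives are asked for on
    open intervals where a power or the solution may fail to have one at an endpoint. The identity
    linking g to its kernel telescopes on partial sums and rests on the Beta integral for the
    improper-integral [Gamma] of the statement. The quotient of the two sides of the Beta formula is
    shown constant by a recursion together with convexity bounds for [Gamma]; the same bounds make
    the Mittag-Leffler series entire. *)

Lemma ex_RInt_cont (f : R -> R) (a b : R) :
  (forall x, continuous f x) -> ex_RInt f a b.
Proof. intros Hf. apply: ex_RInt_continuous => z _. apply Hf. Qed.

Lemma RInt_swapR (f : R -> R) (a b : R) : ex_RInt f a b -> RInt f b a = - RInt f a b.
Proof. move=> H. symmetry. exact: opp_RInt_swap. Qed.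

Lemma RInt_addR (f g : R -> R) (a b : R) : ex_RInt f a b -> ex_RInt g a b ->
  RInt (fun t => f t + g t) a b = RInt f a b + RInt g a b.
Proof. exact: RInt_plus. Qed.

Lemma RInt_subR (f g : R -> R) (a b : R) : ex_RInt f a b -> ex_RInt g a b ->
  RInt (fun t => f t - g t) a b = RInt f a b - RInt g a b.
Proof. exact: RInt_minus. Qed.

Lemma RInt_mulR (k : R) (f : R -> R) (a b : R) : ex_RInt f a b ->
  RInt (fun t => k * f t) a b = k * RInt f a b.
Proof. exact: RInt_scal. Qed.

Lemma is_derive_continuous (F : R -> R) (x l : R) : is_derive F x l -> continuous F x.
Proof. intros H. apply: ex_derive_continuous. exists l; exact H. Qed.

Lemma is_derive_primitive (f : R -> R) (a x : R) :
  (forall x, continuous f x) -> is_derive (fun x => RInt f a x) x (f x).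
Proof.
  intros Hf. apply: (is_derive_RInt f _ a x).
  - exists (mkposreal 1 Rlt_0_1) => y _. apply: RInt_correct. exact: ex_RInt_cont.
  - apply Hf.
Qed.

(** Powers t^a with a < 1 have no derivative at 0. The difference of F and the primitive of f has
    zero derivative inside, and the mean value theorem asks only for continuity at the endpoints. *)
Lemma FTC_open (F f : R -> R) (a b : R) : a <= b ->
  (forall x, a < x < b -> is_derive F x (f x)) ->
  (forall x, continuous F x) -> (forall x, continuous f x) ->
  RInt f a b = F b - F a.
Proof.
  intros Hab HF cF cf.
  destruct (MVT_gen (fun x => F x - RInt f a x) a b (fun _ => 0)) as [c [_ Hc]].
  - rewrite Rmin_left // Rmax_right // => x Hx.
    replace 0 with (minus (f x) (f x)) by (rewrite /minus /plus /opp /=; ring).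
    apply: is_derive_minus; [exact: HF | exact: is_derive_primitive].
  - move=> x _. apply continuity_pt_filterlim.
    apply: continuous_minus; [exact: cF |].
    apply: is_derive_continuous. exact: is_derive_primitive.
  - move: Hc. rewrite RInt_point /zero /=. lra.
Qed.

Lemma derive_nonneg_le (F f : R -> R) (a b : R) : a <= b ->
  (forall x, a < x < b -> is_derive F x (f x)) ->
  (forall x, a < x < b -> 0 <= f x) ->
  (forall x, continuous F x) -> F a <= F b.
Proof.
  intros Hab HF Hf cF.
  (* The mean value point may be an endpoint, where nothing is known of [f]; the default value 0
     there keeps the sign. *)
  destruct (MVT_gen F a b (fun x => if Rlt_dec a x is left _ then
     (if Rlt_dec x b is left _ then f x else 0) else 0)) as [c [Hc Heq]].
  - rewrite Rmin_left // Rmax_right // => x Hx.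
    destruct (Rlt_dec a x); [destruct (Rlt_dec x b)|]; try lra. exact: HF.
  - move=> x _. apply continuity_pt_filterlim. apply cF.
  - enough (0 <= F b - F a) by lra. rewrite Heq.
    apply Rmult_le_pos; [|lra].
    destruct (Rlt_dec a c); [destruct (Rlt_dec c b)|]; try lra. apply Hf; lra.
Qed.

Lemma continuous_RInt_param (h : R -> R -> R) (a b x : R) : a <= b ->
  (forall x t, continuity_2d_pt h x t) ->
  continuous (fun x => RInt (h x) a b) x.
Proof.
  intros Hab Hh.
  assert (hc : forall x t, continuous (h x) t).
  { move=> y t. apply/filterlim_locally => eps.
    destruct (Hh y t eps) as [d Hd]. exists d => z Hz.
    apply Hd; last exact Hz. rewrite Rminus_diag Rabs_R0. apply d. }
  apply/filterlim_locally => eps.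
  (* The added 1 keeps the divisor positive when [a = b] and the final inequality strict. *)
  assert (He : 0 < eps / (b - a + 1)).
  { apply Rdiv_lt_0_compat; [apply eps | lra]. }
  destruct (uniform_continuity_2d_1d (fun t y => h y t) a b x) with (eps := mkposreal _ He)
    as [d Hd].
  { move=> t _. move=> e. destruct (Hh x t e) as [d Hd]. exists d => u v Hu Hv. exact: Hd. }
  exists d => y Hy. rewrite /ball /= /AbsRing_ball /= /abs /minus /plus /opp /=.
  rewrite -/(Rminus _ _) -RInt_subR; try exact: ex_RInt_cont.
  apply Rle_lt_trans with ((b - a) * (eps / (b - a + 1))).
  - apply: abs_RInt_le_const => //.
    + apply: ex_RInt_minus; exact: ex_RInt_cont.
    + move=> t Ht. apply Rlt_le.
      assert (Hdp := cond_pos d).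
      assert (Hy' : Rabs (y - x) < d) by exact Hy.
      apply Rabs_def2 in Hy'.
      apply (Hd t x t y); try lra.
      rewrite Rminus_diag Rabs_R0. exact Hdp.
  - replace (pos eps) with ((b - a + 1) * (eps / (b - a + 1))) at 2 by (field; lra).
    apply Rmult_lt_compat_r; [exact He | lra].
Qed.

Lemma Leibniz (f df : R -> R -> R) (x : R) :
  (forall x t, is_derive (fun u => f u t) x (df x t)) ->
  (forall x t, continuity_2d_pt df x t) ->
  (forall x t, continuous (f x) t) ->
  is_derive (fun x => RInt (f x) 0 x) x (RInt (df x) 0 x + f x x).
Proof.
  intros Hd Hc Hf.
  assert (HD : forall x t, Derive (fun u => f u t) x = df x t).
  { move=> y t. exact: is_derive_unique. }
  assert (Hc2 : forall x t, continuity_2d_pt (fun u v => Derive (fun z => f z v) u) x t).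
  { move=> y t. apply continuity_2d_pt_ext with df; [|exact: Hc].
    move=> u v. by rewrite HD. }
  rewrite -(RInt_ext (fun t => Derive (fun u => f u t) x)); last by move=> t _.
  replace (f x x) with (f x x * 1) by ring.
  apply: (is_derive_RInt_param_bound_comp_aux3 f 0 (fun x => x) x 1).
  - exists (mkposreal 1 Rlt_0_1) => y _. exact: ex_RInt_cont.
  - exists (mkposreal 1 Rlt_0_1). exists (mkposreal 1 Rlt_0_1) => y _. exact: ex_RInt_cont.
  - apply: is_derive_id.
  - exists (mkposreal 1 Rlt_0_1). exists (mkposreal 1 Rlt_0_1) => y _ t _. by exists (df y t).
  - move=> t _. exact: Hc2.
  - exists (mkposreal 1 Rlt_0_1) => u v _ _. exact: Hc2.
  - apply continuity_pt_filterlim. apply Hf.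
Qed.

(** * Convolution *)

Ltac cont2 :=
  intros;
  lazymatch goal with
  | |- continuity_2d_pt (fun x y => _ * _) _ _ => apply continuity_2d_pt_mult; cont2
  | |- continuity_2d_pt Rmult _ _ =>
      apply (continuity_2d_pt_mult (fun u _ => u) (fun _ v => v)); cont2
  | |- continuity_2d_pt Rminus _ _ =>
      apply (continuity_2d_pt_minus (fun u _ => u) (fun _ v => v)); cont2
  | |- continuity_2d_pt (fun x y => _ - _) _ _ => apply continuity_2d_pt_minus; cont2
  | |- continuity_2d_pt (fun x y => _ + _) _ _ => apply continuity_2d_pt_plus; cont2
  | |- continuity_2d_pt (fun x y => x) _ _ => apply continuity_2d_pt_id1
  | |- continuity_2d_pt (fun x y => y) _ _ => apply continuity_2d_pt_id2
  | |- continuity_2d_pt (fun x y => ?f (@?g x y)) _ _ =>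
      apply (continuity_1d_2d_pt_comp f g); [apply continuity_pt_filterlim; match goal with H : forall x, continuous f x |- _ => apply H end | cont2]
  | |- continuity_2d_pt (fun x y => _) _ _ => apply continuity_2d_pt_const
  | _ => idtac
  end.

Ltac cont1 :=
  intros;
  first [apply continuous_const |
  lazymatch goal with
  | |- continuous (fun x => x) _ => apply continuous_id
  | |- continuous (fun x => _ * _) _ => apply: continuous_mult; cont1
  | |- continuous (fun x => _ - _) _ => apply: continuous_minus; cont1
  | |- continuous (fun x => _ + _) _ => apply: continuous_plus; cont1
  | |- continuous (fun x => - _) _ => apply: continuous_opp; cont1
  | |- continuous (fun x => ?f (@?g x)) _ =>
      first [solve [auto] | apply: (continuous_comp g f); cont1]
  | |- continuous (Rmult ?c) ?x => change (continuous (fun y => c * y) x);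
      apply: continuous_mult; [apply continuous_const | apply continuous_id]
  | |- continuous (Rminus ?c) ?x => change (continuous (fun y => c - y) x);
      apply: continuous_minus; [apply continuous_const | apply continuous_id]
  | |- continuous (Rplus ?c) ?x => change (continuous (fun y => c + y) x);
      apply: continuous_plus; [apply continuous_const | apply continuous_id]
  | |- continuous ?f _ => solve [auto]
  | _ => idtac
  end].

Ltac rring := lazymatch goal with |- ?a = ?b => change (@eq R a b); ring end.

Ltac rfield := lazymatch goal with |- ?a = ?b => change (@eq R a b); field end.

Ltac exint := apply: ex_RInt_cont; cont1.

Definition conv (f g : R -> R) (t : R) : R := RInt (fun s => f (t - s) * g s) 0 t.

Lemma conv_0 (f g : R -> R) : conv f g 0 = 0.
Proof. exact: RInt_point. Qed.

Section Convolution.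

Variables f g h : R -> R.
Hypotheses (cf : forall x, continuous f x) (cg : forall x, continuous g x)
  (ch : forall x, continuous h x).

Lemma RInt_conv_shift (a t : R) :
  RInt (fun s => f (t - s) * g (s - a)) a t = conv f g (t - a).
Proof.
  rewrite /conv.
  transitivity (RInt (fun s => f (t - a - s) * g s) (1 * a + - a) (1 * t + - a)).
  - rewrite -RInt_comp_lin; last by exint.
    apply RInt_ext => s _. rewrite /scal /= /mult /= Rmult_1_l.
    f_equal; f_equal; ring.
  - f_equal; ring.
Qed.

Lemma conv_comm (t : R) : conv f g t = conv g f t.
Proof.
  rewrite /conv RInt_swapR; last by exint.
  transitivity (- RInt (fun s => f (t - s) * g s) (-1 * 0 + t) (-1 * t + t)).
  { f_equal; f_equal; ring. }
  rewrite -RInt_comp_lin; last by exint.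
  rewrite -[LHS]/(- RInt (fun y => -1 * (f (t - (-1 * y + t)) * g (-1 * y + t))) 0 t).
  rewrite RInt_mulR; last by exint.
  rewrite -Ropp_mult_distr_l Ropp_involutive Rmult_1_l.
  apply RInt_ext => s _.
  replace (t - (-1 * s + t)) with s by ring.
  replace (-1 * s + t) with (t - s) by ring. rring.
Qed.

(** Substituting s = t u fixes the interval to [0, 1], so that [t] remains only in a jointly
    continuous integrand. *)
Lemma conv_continuous (t : R) : continuous (conv f g) t.
Proof.
  apply (continuous_ext (fun t => t * RInt (fun u => f (t - t * u) * g (t * u)) 0 1)).
  - move=> x. rewrite /conv -RInt_mulR; last by exint.
    transitivity (RInt (fun s => f (x - s) * g s) (x * 0 + 0) (x * 1 + 0)).
    + rewrite -RInt_comp_lin; last by exint.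
      apply RInt_ext => s _. rewrite /scal /= /mult /= Rplus_0_r. rring.
    + f_equal; ring.
  - apply: continuous_mult; first by apply: continuous_id.
    apply: (continuous_RInt_param (fun t u => f (t - t * u) * g (t * u))); first lra.
    cont2.
Qed.

End Convolution.

Lemma conv_linear_r (f g h : R -> R) (c t : R) :
  (forall x, continuous f x) -> (forall x, continuous g x) -> (forall x, continuous h x) ->
  conv f (fun s => g s + c * h s) t = conv f g t + c * conv f h t.
Proof.
  intros cf cg ch. rewrite /conv -RInt_mulR; last by exint.
  rewrite -RInt_addR; try by exint.
  apply RInt_ext => s _. rring.
Qed.

Lemma conv_derive (f df g : R -> R) (t : R) :
  (forall x, is_derive f x (df x)) -> (forall x, continuous df x) ->
  (forall x, continuous g x) ->
  is_derive (conv f g) t (conv df g t + f 0 * g t).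
Proof.
  intros Hf cdf cg.
  assert (cf : forall x, continuous f x).
  { move=> x. exact: is_derive_continuous. }
  replace (f 0) with (f (t - t)) by (f_equal; ring).
  apply: (Leibniz (fun t s => f (t - s) * g s) (fun t s => df (t - s) * g s)).
  - move=> x s. auto_derive; [by exists (df (x - s)) |].
    rewrite Rmult_1_l. f_equal. exact: is_derive_unique.
  - cont2.
  - cont1.
Qed.

(* Triangle Fubini: both iterated integrals, truncated at u <= x, have the same derivative in x. *)
Lemma conv_assoc (f g h : R -> R) (t : R) : 0 <= t ->
  (forall x, continuous f x) -> (forall x, continuous g x) -> (forall x, continuous h x) ->
  conv f (conv g h) t = conv (conv f g) h t.
Proof.
  intros Ht cf cg ch.
  assert (ccgh := conv_continuous g h cg ch).
  (* Inner integral of the swapped order, cut at [x]. Differentiating the outer integral gives an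
     endpoint term with [N x x = 0], and at [x = t] the inner integral is [conv f g (t - v)]. *)
  pose (N := fun x v => RInt (fun u => f (t - u) * g (u - v)) v x).
  assert (HN : forall x v, continuous (N x) v).
  { move=> x v.
    apply (continuous_ext (fun v => (x - v) *
       RInt (fun u => f (t - v - (x - v) * u) * g ((x - v) * u)) 0 1)).
    - move=> w. rewrite /N -RInt_mulR; last by exint.
      transitivity (RInt (fun u => f (t - u) * g (u - w)) ((x - w) * 0 + w) ((x - w) * 1 + w)).
      + rewrite -RInt_comp_lin; last by exint.
        apply RInt_ext => s _. rewrite /scal /= /mult /=.
        f_equal; f_equal; f_equal; ring.
      + f_equal; ring.
    - apply: continuous_mult; first by cont1.
      apply: (continuous_RInt_param (fun v u => f (t - v - (x - v) * u) * g ((x - v) * u))); first lra.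
      cont2. }
  pose (B := fun x => RInt (fun v => N x v * h v) 0 x).
  assert (HB : forall x, is_derive B x (f (t - x) * conv g h x)).
  { move=> x.
    replace (f (t - x) * conv g h x) with
      (RInt (fun v => f (t - x) * g (x - v) * h v) 0 x + N x x * h x).
    - apply: (Leibniz (fun x v => N x v * h v) (fun x v => f (t - x) * g (x - v) * h v)).
      + move=> y v.
        replace (f (t - y) * g (y - v) * h v) with
          (scal (f (t - y) * g (y - v)) (h v)) by reflexivity.
        apply: is_derive_scal_l.
        apply: (is_derive_primitive (fun u => f (t - u) * g (u - v))). cont1.
      + cont2.
      + move=> y v. apply: continuous_mult; [exact: HN | exact: ch].
    - rewrite /N RInt_point /zero /= Rmult_0_l Rplus_0_r /conv -RInt_mulR; last by exint.
      apply RInt_ext => s _. rring. }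
  transitivity (B t - B 0).
  - apply FTC_open => //; last by cont1.
    move=> x. apply: is_derive_continuous. exact: HB.
  - rewrite /B RInt_point /zero /= Rminus_0_r /conv.
    apply RInt_ext => v _. by rewrite /N RInt_conv_shift.
Qed.

(** * Alikhanov's inequality *)

Section Alikhanov.

Variables (k dk m : R -> R).
Hypotheses (ck : forall x, continuous k x) (k0 : forall x, 0 <= x -> 0 <= k x)
  (kd : forall x, 0 < x -> is_derive k x (dk x)) (dk0 : forall x, 0 < x -> dk x <= 0)
  (cm : forall x, continuous m x).

Let w : R -> R := fun t => RInt m 0 t.
Let K : R -> R := fun t => RInt k 0 t.

Let dw t : is_derive w t (m t).
Proof. exact: is_derive_primitive. Qed.

Let dK t : is_derive K t (k t).
Proof. exact: is_derive_primitive. Qed.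

Let cw t : continuous w t.
Proof. exact: is_derive_continuous. Qed.

Let cK t : continuous K t.
Proof. exact: is_derive_continuous. Qed.

(* With D(s) = w t - w s, d/ds (k(t-s) D^2) = - k'(t-s) D^2 - 2 k(t-s) D w'(s), where k' <= 0. *)
Lemma conv_square_le (t : R) : 0 <= t ->
  conv k (fun s => w s * m s) t <= w t * conv k m t.
Proof.
  intros Ht.
  enough (H : 0 <= RInt (fun s => k (t - s) * ((w t - w s) * m s)) 0 t).
  { rewrite /conv -RInt_mulR; last by exint.
    apply Rminus_le_0. rewrite -RInt_subR; try by exint.
    erewrite RInt_ext; first exact H.
    move=> s _ /=. rring. }
  pose (f := fun s => k (t - s) * ((w t - w s) * m s)).
  assert (cf : forall x, continuous f x) by (rewrite /f; cont1).
  pose (F := (fun x => RInt f 0 x) : R -> R).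
  assert (dF : forall x, is_derive F x (f x)) by (move=> x; exact: is_derive_primitive).
  assert (F0 : F 0 = 0) by (rewrite /F RInt_point //).
  assert (Ft : RInt f 0 t = F t) by done.
  clearbody F. rewrite -/f Ft.
  pose (H := fun x => 2 * F x + k (t - x) * ((w t - w x) * (w t - w x))).
  assert (H0 : H 0 <= H t).
  { apply (derive_nonneg_le H (fun x => - dk (t - x) * ((w t - w x) * (w t - w x)))) => //.
    - move=> x Hx.
      assert (D1 := dF x).
      assert (D2 := kd (t - x) ltac:(lra)).
      assert (D3 := dw x).
      rewrite /H. auto_derive.
      + repeat split; eexists; eassumption.
      + rewrite -?/(Rminus _ _) (is_derive_unique (fun x => F x) _ _ D1).
        rewrite (is_derive_unique (fun x => k x) _ _ D2).
        rewrite (is_derive_unique (fun x => w x) _ _ D3) /f. ring.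
    - move=> x Hx. apply Rmult_le_pos; last by apply: Rle_0_sqr.
      have := dk0 (t - x) ltac:(lra). lra.
    - move=> x. rewrite /H. apply: continuous_plus; last by cont1.
      apply: continuous_mult; first by apply continuous_const.
      apply: is_derive_continuous. exact: dF. }
  (* At 0 the function [H] is k(t) w(t)^2 >= 0, because w(0) = 0; at [t] it is [2 * F t]. *)
  move: H0. rewrite /H F0 !Rminus_0_r !Rminus_diag.
  have := k0 t Ht. have : w 0 = 0 by rewrite /w RInt_point.
  move=> -> ? ?. nra.
Qed.

(** Integration by parts rewrites the difference of the two sides as \int w (k * m). By
    [conv_square_le] this is at least \int k * (w m), which equals half of \int k(tau - s) w(s)^2
    ds. *)
Lemma energy_smooth_kernel (tau : R) : 0 <= tau ->
  RInt (fun t => m t * conv K m t) 0 tau <= w tau * conv K m tau.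
Proof.
  intros Ht.
  assert (K0 : K 0 = 0) by (rewrite /K RInt_point //).
  assert (w0 : w 0 = 0) by (rewrite /w RInt_point //).
  assert (cX := conv_continuous K m cK cm).
  assert (ckm := conv_continuous k m ck cm).
  assert (cwm : forall x, continuous (fun s => w s * m s) x) by cont1.
  assert (ckwm := conv_continuous k _ ck cwm).
  assert (dconv : forall g, (forall x, continuous g x) ->
    forall x, is_derive (conv K g) x (conv k g x)).
  { move=> g cg x. replace (conv k g x) with (conv k g x + K 0 * g x) by (rewrite K0; ring).
    exact: conv_derive. }
  assert (E1 : RInt (fun t => m t * conv K m t + w t * conv k m t) 0 tau = w tau * conv K m tau).
  { rewrite (FTC_open (fun t => w t * conv K m t)) //.
    - rewrite w0. rring.
    - move=> x _.
      apply: (is_derive_mult w (conv K m) x (m x) (conv k m x)) => //.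
      + exact: dconv.
      + move=> a b. exact: Rmult_comm.
    - cont1.
    - cont1. }
  rewrite RInt_addR in E1; try by exint.
  assert (E2 : RInt (conv k (fun s => w s * m s)) 0 tau = conv K (fun s => w s * m s) tau).
  { rewrite (FTC_open (conv K (fun s => w s * m s))) //.
    - rewrite conv_0. rring.
    - move=> x _. exact: dconv.
    - exact: conv_continuous. }
  (* Since 2 w m is the derivative of w^2, an integration by parts moves the derivative to [K]; the
     boundary terms vanish by [K 0 = 0] and [w 0 = 0]. *)
  assert (E3 : 2 * conv K (fun s => w s * m s) tau = RInt (fun s => k (tau - s) * (w s * w s)) 0 tau).
  { rewrite /conv -RInt_mulR; last by exint.
    apply Rminus_diag_uniq. rewrite -RInt_subR; try by exint.
    rewrite (FTC_open (fun s => K (tau - s) * (w s * w s))) //.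
    - rewrite w0 Rminus_diag K0. rring.
    - move=> x _. assert (D1 := dK (tau - x)). assert (D2 := dw x).
      auto_derive.
      + repeat split; eexists; eassumption.
      + rewrite -?/(Rminus _ _) (is_derive_unique (fun x => K x) _ _ D1) (is_derive_unique (fun x => w x) _ _ D2).
        ring.
    - cont1.
    - cont1. }
  assert (I1 : RInt (conv k (fun s => w s * m s)) 0 tau <= RInt (fun t => w t * conv k m t) 0 tau).
  { apply RInt_le => //; try by exint.
    move=> x Hx. apply conv_square_le. lra. }
  assert (I2 : 0 <= RInt (fun s => k (tau - s) * (w s * w s)) 0 tau).
  { apply RInt_ge_0 => //; first by exint.
    move=> x Hx. apply Rmult_le_pos; [apply k0; lra | nra]. }
  lra.
Qed.

End Alikhanov.

(** * The power kernel *)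

(* Rpower 0 a = 1 in the standard library; this is the power function vanishing on (-oo, 0]. *)
Definition rpow (a t : R) : R := if Rle_dec t 0 is left _ then 0 else Rpower t a.

Lemma rpow_nonpos (a t : R) : t <= 0 -> rpow a t = 0.
Proof. rewrite /rpow. by case: Rle_dec. Qed.

Lemma rpow_pos (a t : R) : 0 < t -> rpow a t = Rpower t a.
Proof. rewrite /rpow. case: Rle_dec => //. lra. Qed.

Lemma Rpower_gt0 (t a : R) : 0 < Rpower t a.
Proof. apply exp_pos. Qed.

Lemma rpow_ge0 (a t : R) : 0 <= rpow a t.
Proof.
  rewrite /rpow. case: Rle_dec => _; [lra |]. apply Rlt_le, Rpower_gt0.
Qed.

Lemma rpow_le (a s t : R) : 0 <= a -> s <= t -> rpow a s <= rpow a t.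
Proof.
  intros Ha Hst. destruct (Rle_dec s 0) as [Hs|Hs].
  - rewrite (rpow_nonpos a s) //. exact: rpow_ge0.
  - rewrite !rpow_pos; try lra. apply Rle_Rpower_l; lra.
Qed.

Lemma rpow_small (a eps : R) : 0 < a -> 0 < eps ->
  exists d, 0 < d /\ forall t, t <= d -> rpow a t <= eps.
Proof.
  intros Ha He. exists (Rpower eps (/ a)). split; first exact: Rpower_gt0.
  move=> t Ht. apply Rle_trans with (rpow a (Rpower eps (/ a))).
  - apply rpow_le; lra.
  - rewrite rpow_pos; last by exact: Rpower_gt0.
    rewrite Rpower_mult Rinv_l; last by lra. rewrite Rpower_1 //. lra.
Qed.

Lemma is_derive_Rpower (a t : R) : 0 < t ->
  is_derive (fun t => Rpower t a) t (a * Rpower t (a - 1)).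
Proof. move=> Ht. apply is_derive_Reals. exact: derivable_pt_lim_power. Qed.

Lemma is_derive_rpow (a t : R) : 0 < t -> is_derive (rpow a) t (a * Rpower t (a - 1)).
Proof.
  intros Ht. apply: (is_derive_ext_loc (fun t => Rpower t a)).
  - exists (mkposreal t Ht) => y Hy.
    rewrite rpow_pos //. move: Hy. rewrite /ball /= /AbsRing_ball /abs /minus /plus /opp /= => Hy.
    apply Rabs_def2 in Hy. lra.
  - exact: is_derive_Rpower.
Qed.

Lemma continuous_rpow (a t : R) : 0 < a -> continuous (rpow a) t.
Proof.
  intros Ha. destruct (Rtotal_order t 0) as [Ht|[->|Ht]].
  - apply (continuous_ext_loc _ (fun _ => 0)); last by apply continuous_const.
    assert (Ht' : 0 < - t) by lra.
    exists (mkposreal _ Ht') => y. rewrite /ball /= /AbsRing_ball /abs /minus /plus /opp /= => Hy.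
    apply Rabs_def2 in Hy. rewrite rpow_nonpos //. lra.
  - apply/filterlim_locally => eps.
    destruct (rpow_small a (eps / 2) Ha) as [d [Hd H]].
    { have := cond_pos eps. lra. }
    exists (mkposreal d Hd) => y.
    rewrite /ball /= /AbsRing_ball /abs /minus /plus /opp /= => Hy.
    apply Rabs_def2 in Hy. rewrite (rpow_nonpos a 0); last lra.
    rewrite Ropp_0 Rplus_0_r Rabs_pos_eq; last by exact: rpow_ge0.
    have := H y ltac:(lra). have := cond_pos eps. lra.
  - apply: is_derive_continuous. exact: is_derive_rpow.
Qed.

Lemma rpow_mult_distr (a s t : R) : 0 <= s -> 0 <= t -> rpow a (s * t) = rpow a s * rpow a t.
Proof.
  intros Hs Ht.
  destruct (Req_dec s 0) as [->|Hs0]; first by rewrite Rmult_0_l !(rpow_nonpos a 0); lra.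
  destruct (Req_dec t 0) as [->|Ht0]; first by rewrite Rmult_0_r !(rpow_nonpos a 0); lra.
  rewrite !rpow_pos; try nra. rewrite Rpower_mult_distr //; lra.
Qed.

Lemma rpow_plus (a b t : R) : rpow (a + b) t = rpow a t * rpow b t.
Proof. rewrite /rpow. case: Rle_dec => _; [ring | exact: Rpower_plus]. Qed.

Lemma rpow_1 (t : R) : 0 <= t -> rpow 1 t = t.
Proof.
  intros Ht. rewrite /rpow. case: Rle_dec => H; [lra | rewrite Rpower_1 //; lra].
Qed.

(** A number s in (0, 1) satisfies s <= s^a; applied to t/(t+e) and e/(t+e), whose sum is 1, this
    gives the claim after multiplication by (t+e)^a. *)
Lemma rpow_subadd (a e t : R) : 0 < a < 1 -> 0 < e -> 0 <= t ->
  rpow a (t + e) <= rpow a t + rpow a e.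
Proof.
  intros Ha He Ht. destruct (Req_dec t 0) as [->|Ht0].
  { rewrite Rplus_0_l. have := rpow_ge0 a 0. lra. }
  assert (Hs : forall s, 0 < s < 1 -> s <= Rpower s a).
  { move=> s Hs. replace s with (Rpower s 1) at 1 by (rewrite Rpower_1; lra).
    rewrite /Rpower. assert (ln s < 0) by (rewrite -ln_1; apply ln_increasing; lra).
    destruct (Req_dec (1 * ln s) (a * ln s)) as [->|Hne]; first lra.
    apply Rlt_le, exp_increasing. nra. }
  assert (E : forall x, 0 < x -> rpow a x = rpow a (t + e) * rpow a (x / (t + e))).
  { move=> x Hx. rewrite -rpow_mult_distr; try lra.
    - f_equal. field. lra.
    - apply Rlt_le, Rdiv_lt_0_compat; lra. }
  rewrite (E t); last lra. rewrite (E e) //.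
  assert (H1 : forall x, 0 < x < t + e -> x / (t + e) <= rpow a (x / (t + e))).
  { move=> x Hx. assert (0 < x / (t + e)) by (apply Rdiv_lt_0_compat; lra).
    rewrite rpow_pos //. apply Hs. split => //.
    apply (Rmult_lt_reg_r (t + e)); first lra.
    replace (x / (t + e) * (t + e)) with x by (field; lra). lra. }
  have H2 := H1 t ltac:(lra). have H3 := H1 e ltac:(lra).
  have H4 := rpow_ge0 a (t + e).
  assert (t / (t + e) + e / (t + e) = 1) by (field; lra).
  nra.
Qed.

(** * Stability of the energy inequality under uniform approximation of the kernel *)

Section EnergyLimit.

Variables (K m : R -> R) (tau : R).
Hypotheses (Htau : 0 <= tau) (cK : forall x, continuous K x) (cm : forall x, continuous m x).

Let w : R -> R := fun t => RInt m 0 t.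

Lemma energy_kernel_approx :
  (forall delta, 0 < delta -> exists K' : R -> R,
     (forall x, continuous K' x) /\ (forall x, 0 <= x <= tau -> Rabs (K' x - K x) <= delta) /\
     RInt (fun t => m t * conv K' m t) 0 tau <= w tau * conv K' m tau) ->
  RInt (fun t => m t * conv K m t) 0 tau <= w tau * conv K m tau.
Proof.
  intros H. apply Rnot_lt_le => Hlt.
  pose (A := RInt (fun t => Rabs (m t)) 0 tau).
  assert (cam : forall x, continuous (fun t => Rabs (m t)) x).
  { move=> x. apply: continuous_comp; [exact: cm | exact: continuous_Rabs]. }
  assert (HA : 0 <= A).
  { apply RInt_ge_0 => //; [exint | move=> x _; exact: Rabs_pos]. }
  pose (J := RInt (fun t => m t * conv K m t) 0 tau - w tau * conv K m tau).
  assert (HJ : 0 < J) by (rewrite /J; lra).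
  (* A kernel error of [delta] moves each side by at most delta A^2, so the excess [J] would be at
     most 2 delta A^2 < J; the added 1 covers A = 0. *)
  pose (delta := J / (4 * A * A + 1)).
  assert (Hd : 0 < delta) by (apply Rdiv_lt_0_compat; nra).
  destruct (H delta Hd) as [K' [cK' [HK' HE]]].
  assert (cX := conv_continuous K m cK cm).
  assert (cX' := conv_continuous K' m cK' cm).
  assert (HX : forall t, 0 <= t <= tau -> Rabs (conv K' m t - conv K m t) <= delta * A).
  { move=> t Ht. rewrite /conv -RInt_subR; try by exint.
    eapply Rle_trans; first (apply abs_RInt_le; [lra | exint]).
    apply Rle_trans with (RInt (fun s => delta * Rabs (m s)) 0 t).
    - apply RInt_le; [lra | | exint |].
      + apply: ex_RInt_cont => x.
        apply: continuous_comp; last by exact: continuous_Rabs. cont1.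
      + move=> x Hx.
        replace (K' (t - x) * m x - K (t - x) * m x) with ((K' (t - x) - K (t - x)) * m x) by ring.
        rewrite Rabs_mult. apply Rmult_le_compat_r; [exact: Rabs_pos | apply HK'; lra].
    - rewrite RInt_mulR; last by exint.
      apply Rmult_le_compat_l; first lra.
      rewrite /A -(RInt_Chasles _ 0 t tau); try by exint.
      assert (0 <= RInt (fun t => Rabs (m t)) t tau).
      { apply RInt_ge_0; [lra | exint | move=> x _; exact: Rabs_pos]. }
      rewrite /plus /=. lra. }
  assert (Hw : Rabs (w tau) <= A).
  { apply abs_RInt_le => //. exint. }
  assert (I1 : Rabs (w tau * conv K' m tau - w tau * conv K m tau) <= A * (delta * A)).
  { replace (w tau * conv K' m tau - w tau * conv K m tau)
      with (w tau * (conv K' m tau - conv K m tau)) by ring.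
    rewrite Rabs_mult. apply Rmult_le_compat; try exact: Rabs_pos; first exact: Hw.
    apply HX. lra. }
  assert (I2 : Rabs (RInt (fun t => m t * conv K' m t) 0 tau - RInt (fun t => m t * conv K m t) 0 tau)
    <= delta * A * A).
  { rewrite -RInt_subR; try by exint.
    eapply Rle_trans; first (apply abs_RInt_le; [lra | exint]).
    rewrite /A -RInt_mulR; last by exint.
    apply RInt_le; [lra | | exint |].
    - apply: ex_RInt_cont => x.
      apply: continuous_comp; last by exact: continuous_Rabs. cont1.
    - move=> x Hx.
      replace (m x * conv K' m x - m x * conv K m x) with ((conv K' m x - conv K m x) * m x) by ring.
      rewrite Rabs_mult. apply Rmult_le_compat_r; [exact: Rabs_pos | apply HX; lra]. }
  apply Rabs_le_between in I1. apply Rabs_le_between in I2.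
  assert (HJ2 : delta * (4 * A * A + 1) = J) by (rewrite /delta; field; nra).
  rewrite /J in HJ HJ2. nra.
Qed.

End EnergyLimit.

Lemma energy_rpow (alpha tau : R) (m : R -> R) : 0 < alpha < 1 -> 0 <= tau ->
  (forall x, continuous m x) ->
  RInt (fun t => m t * conv (rpow alpha) m t) 0 tau <= RInt m 0 tau * conv (rpow alpha) m tau.
Proof.
  intros Ha Htau cm.
  assert (cr : forall x, continuous (rpow alpha) x).
  { move=> x. apply continuous_rpow; lra. }
  apply energy_kernel_approx => // delta Hd.
  destruct (rpow_small alpha delta) as [e [He Hed]]; try lra.
  (* The shift [e] removes the singularity and [Rmax] continues [k] continuously to negative
     arguments. For x >= 0 its primitive is (x+e)^alpha - e^alpha; monotonicity and subadditivity of
     the power place it between x^alpha - e^alpha and x^alpha, where e^alpha <= delta. *)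
  pose (k := fun x => alpha * Rpower (Rmax x 0 + e) (alpha - 1)).
  pose (dk := fun x => alpha * ((alpha - 1) * Rpower (x + e) (alpha - 1 - 1))).
  assert (cmax : forall x, continuous (fun x => Rmax x 0) x).
  { move=> x. apply (continuous_ext (fun x => / 2 * (x + Rabs x))).
    - move=> y. rewrite /Rmax /Rabs. case: Rle_dec; case: Rcase_abs; lra.
    - apply: continuous_mult; first by apply continuous_const.
      apply: continuous_plus; [apply continuous_id | exact: continuous_Rabs]. }
  assert (hmax : forall x, 0 <= Rmax x 0) by (move=> x; exact: Rmax_r).
  assert (ck : forall x, continuous k x).
  { move=> x. rewrite /k. apply: continuous_mult; first by apply continuous_const.
    apply: (continuous_comp (fun x => Rmax x 0 + e) (fun y => Rpower y (alpha - 1))).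
    - apply: continuous_plus; [exact: cmax | apply continuous_const].
    - apply: is_derive_continuous. apply: is_derive_Rpower. have := hmax x. lra. }
  assert (kE : forall x, 0 <= x -> k x = alpha * Rpower (x + e) (alpha - 1)).
  { move=> x Hx. rewrite /k Rmax_left //. }
  exists (fun t => RInt k 0 t). split; [|split].
  - move=> x. apply: is_derive_continuous. exact: is_derive_primitive.
  - move=> x Hx.
    rewrite (FTC_open (fun t => rpow alpha (t + e))) //; first last.
    + cont1.
    + move=> y Hy. rewrite kE; last lra.
      replace (alpha * Rpower (y + e) (alpha - 1)) with
        (scal 1 (alpha * Rpower (y + e) (alpha - 1))) by (rewrite /scal /= /mult /=; ring).
      apply: (is_derive_comp (rpow alpha) (fun y => y + e)).
      * apply: is_derive_rpow. lra.
      * auto_derive => //.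
    + lra.
    + rewrite Rplus_0_l.
      have := rpow_subadd alpha e x Ha He ltac:(lra).
      have := rpow_le alpha x (x + e) ltac:(lra) ltac:(lra).
      have := Hed e ltac:(lra).
      move=> ? ? ?. apply Rabs_le. lra.
  - apply (energy_smooth_kernel k dk) => //.
    + move=> x Hx. rewrite kE //. apply Rmult_le_pos; [lra | apply Rlt_le, Rpower_gt0].
    + move=> x Hx.
      apply: (is_derive_ext_loc (fun x => alpha * Rpower (x + e) (alpha - 1))).
      * exists (mkposreal x Hx) => y.
        rewrite /ball /= /AbsRing_ball /abs /minus /plus /opp /= => Hy.
        apply Rabs_def2 in Hy. rewrite kE //. lra.
      * rewrite /dk. apply: is_derive_scal.
        replace ((alpha - 1) * Rpower (x + e) (alpha - 1 - 1)) with
          (scal 1 ((alpha - 1) * Rpower (x + e) (alpha - 1 - 1))) by (rewrite /scal /= /mult /=; ring).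
        apply: (is_derive_comp (fun y => Rpower y (alpha - 1)) (fun y => y + e)).
        -- apply: is_derive_Rpower. lra.
        -- auto_derive => //.
    + move=> x Hx. rewrite /dk. have := Rpower_gt0 (x + e) (alpha - 1 - 1) => H.
      assert (0 < alpha * ((1 - alpha) * Rpower (x + e) (alpha - 1 - 1))).
      { apply Rmult_lt_0_compat; [lra | apply Rmult_lt_0_compat; lra]. }
      lra.
Qed.

(** * Kernels of positive type *)

(* The hypothesis on g says g + k * g = 1 for k(t) = lam a t^(a-1), integrated once so that all
   kernels are continuous. *)
Lemma conv_positive_type (alpha lam tau : R) (g P f : R -> R) :
  0 < alpha < 1 -> 0 < lam -> 0 <= tau ->
  (forall x, continuous g x) -> (forall x, continuous f x) ->
  (forall x, is_derive P x (f x)) ->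
  (forall t, 0 <= t -> lam * conv (rpow alpha) g t = t - RInt g 0 t) ->
  0 <= RInt (fun t => P t * conv g P t) 0 tau.
Proof.
  intros Ha Hlam Htau cg cf dP Hg.
  assert (cP : forall x, continuous P x) by (move=> x; exact: is_derive_continuous).
  assert (cK : forall x, continuous (rpow alpha) x).
  { move=> x. apply continuous_rpow; lra. }
  assert (cfg := conv_continuous f g cf cg).
  assert (cgf := conv_continuous g f cg cf).
  assert (cW := conv_continuous g P cg cP).
  pose (K := rpow alpha). rewrite -/K in cK Hg.
  assert (cKg := conv_continuous K g cK cg).
  (* [M] is the derivative of [conv g P], the w' of the overview. *)
  pose (M := fun t => conv f g t + P 0 * g t).
  assert (cM : forall x, continuous M x) by (rewrite /M; cont1).
  assert (cX := conv_continuous K M cK cM).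
  assert (dW : forall t, is_derive (conv g P) t (M t)).
  { move=> t. apply: (is_derive_ext (conv P g)).
    - move=> s. exact: conv_comm.
    - exact: conv_derive. }
  pose (Q := (fun t => RInt P 0 t) : R -> R).
  assert (dQ : forall t, is_derive Q t (P t)) by (move=> t; exact: is_derive_primitive).
  assert (cQ : forall x, continuous Q x) by (move=> x; exact: is_derive_continuous).
  assert (Q0 : Q 0 = 0) by (rewrite /Q RInt_point //).
  (* By associativity and the hypothesis on [g], convolving [M] with [K] leaves the kernel t - \int
     g against f = P'; an integration by parts then takes the derivative off [P]. *)
  assert (EQ : forall t, 0 <= t -> Q t = conv g P t + lam * conv K M t).
  { move=> t Ht.
    assert (EM : conv K M t = conv (conv K g) f t + P 0 * conv K g t).
    { rewrite -conv_assoc // -(conv_linear_r K) //.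
      apply RInt_ext => s _. rewrite /M (conv_comm f g) //. }
    pose (G := (fun t => RInt g 0 t) : R -> R).
    assert (dG : forall t, is_derive G t (g t)) by (move=> x; exact: is_derive_primitive).
    assert (cG : forall x, continuous G x) by (move=> x; exact: is_derive_continuous).
    assert (G0 : G 0 = 0) by (rewrite /G RInt_point //).
    assert (HG : forall t, 0 <= t -> lam * conv K g t = t - G t) by exact: Hg.
    clearbody G.
    assert (E1 : lam * conv (conv K g) f t = RInt (fun s => (t - s - G (t - s)) * f s) 0 t).
    { rewrite {1}/conv -RInt_mulR; last by exint.
      apply RInt_ext => s. rewrite Rmin_left // Rmax_right // => Hs.
      rewrite -Rmult_assoc HG //. lra. }
    assert (E2 : RInt (fun s => (t - s - G (t - s)) * f s) 0 t
       - RInt (fun s => P s - g (t - s) * P s) 0 t = - ((t - G t) * P 0)).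
    { rewrite -RInt_subR; try by exint.
      rewrite (FTC_open (fun s => (t - s - G (t - s)) * P s)) //.
      - rewrite !Rminus_diag !Rminus_0_r G0. rring.
      - move=> x _. assert (D1 := dG (t - x)). assert (D2 := dP x).
        auto_derive.
        + repeat split; eexists; eassumption.
        + rewrite -?/(Rminus _ _) (is_derive_unique (fun x => G x) _ _ D1)
            (is_derive_unique (fun x => P x) _ _ D2). ring.
      - cont1.
      - cont1. }
    rewrite RInt_subR in E2; try by exint.
    rewrite -/(Q t) -/(conv g P t) in E2.
    rewrite EM Rmult_plus_distr_l E1.
    replace (lam * (P 0 * conv K g t)) with (P 0 * (lam * conv K g t)) by ring.
    rewrite HG //. lra. }
  assert (wM : RInt M 0 tau = conv g P tau).
  { rewrite (FTC_open (conv g P)) // conv_0. rring. }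
  have EN := energy_rpow alpha tau M Ha Htau cM. rewrite -/K wM in EN.
  assert (I1 : RInt (fun t => P t * conv g P t + Q t * M t) 0 tau = Q tau * conv g P tau).
  { rewrite (FTC_open (fun t => Q t * conv g P t)) //; try by cont1.
    - rewrite Q0. rring.
    - move=> x _. apply: (is_derive_mult Q (conv g P) x (P x) (M x)) => // a b. exact: Rmult_comm. }
  assert (I2 : RInt (fun t => conv g P t * M t) 0 tau = / 2 * (conv g P tau * conv g P tau)).
  { rewrite (FTC_open (fun t => / 2 * (conv g P t * conv g P t))) //; try by cont1.
    - rewrite conv_0. rring.
    - move=> x _.
      replace (conv g P x * M x) with (/ 2 * (M x * conv g P x + conv g P x * M x)) by field.
      apply: is_derive_scal.
      apply: (is_derive_mult (conv g P) (conv g P) x (M x) (M x)) => // a b. exact: Rmult_comm. }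
  assert (I3 : RInt (fun t => Q t * M t) 0 tau =
    RInt (fun t => conv g P t * M t) 0 tau + lam * RInt (fun t => M t * conv K M t) 0 tau).
  { rewrite -RInt_mulR; last by exint. rewrite -RInt_addR; try by exint.
    apply RInt_ext => s. rewrite Rmin_left // Rmax_right // => Hs.
    rewrite EQ; last lra. rring. }
  (* What remains is half the square of [conv g P tau] plus [lam] times the difference that [EN]
     shows to be nonnegative. *)
  rewrite RInt_addR in I1; try by exint.
  rewrite I3 I2 (EQ tau) // in I1. nra.
Qed.

(** * The Gamma function *)

Lemma at_right_0_intro (a : R) (P : R -> Prop) :
  0 < a -> (forall x, 0 < x < a -> P x) -> at_right 0 P.
Proof.
  intros Ha H. exists (mkposreal a Ha) => x.
  rewrite /ball /= /AbsRing_ball /abs /minus /plus /opp /= => Hx Hx0.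
  apply Rabs_def2 in Hx. apply H. lra.
Qed.

Lemma filter_prod_0_infty (a b : R) (P : R * R -> Prop) : 0 < a ->
  (forall x y, 0 < x < a -> b < y -> P (x, y)) ->
  filter_prod (at_right 0) (Rbar_locally p_infty) P.
Proof.
  intros Ha H. apply (Filter_prod _ _ _ (fun x => 0 < x < a) (fun y => b < y)).
  - by apply (at_right_0_intro a).
  - by exists b.
  - exact: H.
Qed.

Lemma ex_RInt_pos (f : R -> R) (a b : R) : 0 < a -> 0 < b ->
  (forall t, 0 < t -> continuous f t) -> ex_RInt f a b.
Proof.
  intros Ha Hb Hf. apply: ex_RInt_continuous => z [Hz _]. apply Hf.
  move: Hz. rewrite /Rmin. case: Rle_dec; lra.
Qed.

(** Partial integrals of a nonnegative function grow with the interval, so their supremum is the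
    improper integral. The second conjunct serves to bound that integral from below. *)
Lemma is_RInt_gen_bounded (f : R -> R) (M : R) :
  (forall t, 0 < t -> continuous f t) -> (forall t, 0 < t -> 0 <= f t) ->
  (forall a b, 0 < a <= b -> RInt f a b <= M) ->
  exists L, is_RInt_gen f (at_right 0) (Rbar_locally p_infty) L /\
    forall a b, 0 < a <= b -> RInt f a b <= L.
Proof.
  intros cf f0 HM.
  destruct (completeness (fun v => exists a b, 0 < a <= b /\ v = RInt f a b)) as [L [HL1 HL2]].
  - exists M => v [a [b [Hab ->]]]. exact: HM.
  - exists (RInt f 1 1), 1, 1. split => //. lra.
  - assert (HL : forall a b, 0 < a <= b -> RInt f a b <= L).
    { move=> a b Hab. apply HL1. by exists a, b. }
    exists L. split => // P [eps HP].
    assert (Hex : exists a b, 0 < a <= b /\ L - eps < RInt f a b).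
    { apply NNPP => Hn.
      assert (L <= L - eps); last by have := cond_pos eps; lra.
      apply HL2 => v [a [b [Hab ->]]]. apply Rnot_lt_le => Hlt. apply Hn. by exists a, b. }
    destruct Hex as [a [b [Hab Hlt]]].
    apply (filter_prod_0_infty a b); first lra.
    move=> x y Hx Hy /=. exists (RInt f x y). split.
    + apply: RInt_correct. apply ex_RInt_pos => //; lra.
    + apply HP. rewrite /ball /= /AbsRing_ball /abs /minus /plus /opp /=.
      have H1 := HL x y ltac:(lra).
      assert (E : RInt f x y = RInt f x a + RInt f a b + RInt f b y).
      { rewrite -(RInt_Chasles f x b y); try (apply ex_RInt_pos => //; lra).
        rewrite -(RInt_Chasles f x a b); try (apply ex_RInt_pos => //; lra). done. }
      assert (0 <= RInt f x a).
      { apply RInt_ge_0; [lra | apply ex_RInt_pos => //; lra | move=> z Hz; apply f0; lra]. }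
      assert (0 <= RInt f b y).
      { apply RInt_ge_0; [lra | apply ex_RInt_pos => //; lra | move=> z Hz; apply f0; lra]. }
      apply Rabs_def1; have := cond_pos eps; lra.
Qed.

Definition gamma_integrand (x t : R) : R := Rpower t (x - 1) * exp (- t).

Lemma gamma_integrand_gt0 (x t : R) : 0 < gamma_integrand x t.
Proof. apply Rmult_lt_0_compat; [exact: Rpower_gt0 | exact: exp_pos]. Qed.

(** Written as a combination of two Gamma integrands, so that integration over the half line yields
    the functional equation. *)
Lemma is_derive_Rpower_exp (x t : R) : 0 < t ->
  is_derive (fun t => Rpower t x * exp (- t)) t
    (x * gamma_integrand x t - gamma_integrand (x + 1) t).
Proof.
  intros Ht. rewrite /gamma_integrand.
  replace (x + 1 - 1) with x by ring.
  replace (x * (Rpower t (x - 1) * exp (- t)) - Rpower t x * exp (- t)) with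
    (x * Rpower t (x - 1) * exp (- t) + Rpower t x * (- exp (- t))) by ring.
  apply: (is_derive_mult (fun t => Rpower t x) (fun t => exp (- t))).
  - exact: is_derive_Rpower.
  - auto_derive => //. ring.
  - move=> a b. exact: Rmult_comm.
Qed.

Lemma continuous_gamma_integrand (x t : R) : 0 < t -> continuous (gamma_integrand x) t.
Proof. move=> Ht. apply: is_derive_continuous. exact: is_derive_Rpower_exp. Qed.

Lemma ln_le_sub1 (u : R) : 0 < u -> ln u <= u - 1.
Proof. intros Hu. have := exp_ineq1_le (ln u). rewrite exp_ln //. lra. Qed.

(** Logarithmic form of t^y e^(-t) <= y^y e^(-y): the maximum is at t = y. *)
Lemma mul_ln_le (y t : R) : 0 < y -> 0 < t -> y * ln t <= y * ln y - y + t.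
Proof.
  intros Hy Ht. have := ln_le_sub1 (t / y) ltac:(exact: Rdiv_lt_0_compat).
  rewrite ln_div // => H.
  apply (Rmult_le_compat_l y) in H; last lra.
  replace (y * (t / y - 1)) with (t - y) in H by (field; lra). lra.
Qed.

(* The integrand is dominated by the derivative of the bounded function C/x (t/(1+t))^x. *)
Lemma RInt_gamma_integrand_bounded (x : R) : 0 < x ->
  exists M, forall a b, 0 < a <= b -> RInt (gamma_integrand x) a b <= M.
Proof.
  intros Hx.
  (* Domination amounts to (1+t)^(x+1) e^(-t) <= e^c; [mul_ln_le] at 1 + t with y = x + 1 gives this
     [c], the last 1 coming from e^(-t) = e e^(-(1+t)). *)
  pose (c := (x + 1) * ln (x + 1) - (x + 1) + 1).
  exists (exp c / x) => a b Hab.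
  pose (F := fun t => exp c / x * exp (x * (ln t - ln (1 + t)))).
  pose (dF := fun t => exp c * exp (x * (ln t - ln (1 + t))) * (/ t - / (1 + t))).
  assert (HF : is_RInt dF a b (minus (F b) (F a))).
  { apply: is_RInt_derive => t; rewrite Rmin_left ?Rmax_right; try lra; move=> Ht.
    - rewrite /F /dF. auto_derive; first lra. rewrite -?/(Rminus _ _). field. lra.
    - apply: ex_derive_continuous. rewrite /dF. auto_derive. lra. }
  apply Rle_trans with (RInt dF a b).
  - apply RInt_le; [lra | | by exists (minus (F b) (F a)) |].
    + apply ex_RInt_pos; try lra. move=> t. exact: continuous_gamma_integrand.
    + move=> t Ht. rewrite /gamma_integrand /Rpower /dF.
      replace (/ t - / (1 + t)) with (/ t * / (1 + t)) by (field; lra).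
      replace (/ t) with (exp (- ln t)) by (rewrite exp_Ropp exp_ln; lra).
      replace (/ (1 + t)) with (exp (- ln (1 + t))) by (rewrite exp_Ropp exp_ln; lra).
      rewrite -!exp_plus.
      assert (H := mul_ln_le (x + 1) (1 + t) ltac:(lra) ltac:(lra)).
      match goal with |- exp ?u <= exp ?v => destruct (Rle_lt_or_eq_dec u v) as [Hl|He] end.
      * rewrite /c. nra.
      * apply Rlt_le. exact: exp_increasing.
      * rewrite He. lra.
  - rewrite (is_RInt_unique _ _ _ _ HF) /minus /plus /opp /= /F.
    assert (Hc : 0 < exp c / x) by (apply Rdiv_lt_0_compat => //; exact: exp_pos).
    assert (0 < exp (x * (ln a - ln (1 + a)))) by exact: exp_pos.
    assert (exp (x * (ln b - ln (1 + b))) <= 1).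
    { rewrite -{2}exp_0. apply Rlt_le, exp_increasing.
      assert (ln b < ln (1 + b)) by (apply ln_increasing; lra). nra. }
    nra.
Qed.

(** [RInt_gen] has a value even for a divergent integral, so convergence must be known before the
    defining integral can be manipulated. *)
Lemma Gamma_is_RInt_gen (x : R) : 0 < x ->
  is_RInt_gen (gamma_integrand x) (at_right 0) (Rbar_locally p_infty) (Gamma x) /\
  0 < Gamma x.
Proof.
  intros Hx. destruct (RInt_gamma_integrand_bounded x Hx) as [M HM].
  destruct (is_RInt_gen_bounded (gamma_integrand x) M) as [L [HL HL']] => //.
  - move=> t. exact: continuous_gamma_integrand.
  - move=> t _. apply Rlt_le, gamma_integrand_gt0.
  - assert (E : Gamma x = L) by apply (is_RInt_gen_unique (gamma_integrand x) L HL).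
    rewrite E. split; first exact HL.
    apply Rlt_le_trans with (RInt (gamma_integrand x) 1 2); last by apply HL'; lra.
    apply RInt_gt_0; [lra | |].
    + move=> t _. exact: gamma_integrand_gt0.
    + move=> t Ht. apply continuous_gamma_integrand. lra.
Qed.

Lemma Gamma_gt0 (x : R) : 0 < x -> 0 < Gamma x.
Proof. move=> Hx. by case: (Gamma_is_RInt_gen x Hx). Qed.

Lemma is_RInt_gen_derive_0_infty (F f : R -> R) (l0 l1 : R) :
  (forall t, 0 < t -> is_derive F t (f t)) -> (forall t, 0 < t -> continuous f t) ->
  filterlim F (at_right 0) (locally l0) -> filterlim F (Rbar_locally p_infty) (locally l1) ->
  is_RInt_gen f (at_right 0) (Rbar_locally p_infty) (l1 - l0).
Proof.
  intros dF cf H0 H1.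
  assert (HD : forall t, 0 < t -> Derive F t = f t).
  { move=> t Ht. apply is_derive_unique. exact: dF. }
  assert (Hmin : forall x y t, 0 < x < 1 -> 1 < y -> Rmin x y <= t <= Rmax x y -> 0 < t).
  { move=> x y t Hx Hy. rewrite Rmin_left; lra. }
  apply: (is_RInt_gen_ext (Derive F)).
  - apply (filter_prod_0_infty 1 1); first lra.
    move=> x y Hx Hy t /= Ht. apply HD. apply (Hmin x y) => //. lra.
  - apply: is_RInt_gen_Derive => //.
    + apply (filter_prod_0_infty 1 1); first lra.
      move=> x y Hx Hy t /= Ht. exists (f t). apply dF. exact: (Hmin x y).
    + apply (filter_prod_0_infty 1 1); first lra.
      move=> x y Hx Hy t /= Ht. assert (Ht0 := Hmin x y t Hx Hy Ht).
      apply (continuous_ext_loc _ f); last by apply cf.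
      exists (mkposreal t Ht0) => z.
      rewrite /ball /= /AbsRing_ball /abs /minus /plus /opp /= => Hz.
      apply Rabs_def2 in Hz. symmetry. apply HD. lra.
Qed.

Lemma filterlim_at_right_continuous (F : R -> R) (a : R) :
  continuous F a -> filterlim F (at_right a) (locally (F a)).
Proof.
  intros H. apply: filterlim_filter_le_1; last exact H. exact: filter_le_within.
Qed.

Lemma Gamma_1 : Gamma 1 = 1.
Proof.
  apply (is_RInt_gen_unique (gamma_integrand 1)).
  replace 1 with (0 - (-1)) at 2 by ring.
  apply (is_RInt_gen_derive_0_infty (fun t => - exp (- t))).
  - move=> t Ht. rewrite /gamma_integrand Rminus_diag Rpower_O //. auto_derive => //. ring.
  - move=> t Ht. exact: (continuous_gamma_integrand 1).
  - replace (-1) with ((fun t => - exp (- t)) 0) by (rewrite /= Ropp_0 exp_0; ring).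
    apply (filterlim_at_right_continuous (fun t => - exp (- t)) 0).
    apply: ex_derive_continuous. by auto_derive.
  - apply/filterlim_locally => eps. exists (/ eps) => t Ht.
    have He := cond_pos eps. have Hie := Rinv_0_lt_compat _ He.
    rewrite /ball /= /AbsRing_ball /abs /minus /plus /opp /=.
    rewrite Ropp_0 Rplus_0_r Rabs_Ropp Rabs_pos_eq; last by apply Rlt_le, exp_pos.
    rewrite exp_Ropp. rewrite -(Rinv_inv eps). apply Rinv_lt_contravar.
    + apply Rmult_lt_0_compat; [exact Hie | exact: exp_pos].
    + have := exp_ineq1_le t. lra.
Qed.

(** The function t^x e^(-t) tends to 0 at both ends, so its derivative integrates to 0; uniqueness
    of the improper integral compares this with the termwise value. *)
Lemma Gamma_succ (x : R) : 0 < x -> Gamma (x + 1) = x * Gamma x.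
Proof.
  intros Hx.
  destruct (Gamma_is_RInt_gen x Hx) as [G1 _].
  destruct (Gamma_is_RInt_gen (x + 1) ltac:(lra)) as [G2 _].
  pose (h := fun t => x * gamma_integrand x t - gamma_integrand (x + 1) t).
  assert (E : is_RInt_gen h (at_right 0) (Rbar_locally p_infty) (0 - 0)).
  { apply (is_RInt_gen_derive_0_infty (fun t => Rpower t x * exp (- t))).
    - move=> t. exact: is_derive_Rpower_exp.
    - move=> t Ht. apply: continuous_minus; last by exact: continuous_gamma_integrand.
      apply: continuous_mult; first by apply continuous_const.
      exact: continuous_gamma_integrand.
    - apply/filterlim_locally => eps. have He := cond_pos eps.
      destruct (rpow_small x (eps / 2)) as [d [Hd H]]; try lra.
      apply (at_right_0_intro d) => // t Ht.
      rewrite /ball /= /AbsRing_ball /abs /minus /plus /opp /=.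
      rewrite Ropp_0 Rplus_0_r Rabs_pos_eq; last first.
      { apply Rlt_le, Rmult_lt_0_compat; [exact: Rpower_gt0 | exact: exp_pos]. }
      have H1 := H t ltac:(lra). rewrite rpow_pos in H1; last lra.
      assert (exp (- t) <= 1) by (rewrite -exp_0; apply Rlt_le, exp_increasing; lra).
      have := exp_pos (- t). have := Rpower_gt0 t x. nra.
    - apply/filterlim_locally => eps. have He := cond_pos eps.
      (* The maximum of t^(x+1) e^(-t); hence t^x e^(-t) <= c/t, which is below [eps] beyond
         c/eps. *)
      pose (c := exp ((x + 1) * ln (x + 1) - (x + 1))).
      assert (Hc : 0 < c) by exact: exp_pos.
      exists (c / eps) => t Ht.
      assert (0 < c / eps) by exact: Rdiv_lt_0_compat.
      rewrite /ball /= /AbsRing_ball /abs /minus /plus /opp /=.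
      rewrite Ropp_0 Rplus_0_r Rabs_pos_eq; last first.
      { apply Rlt_le, Rmult_lt_0_compat; [exact: Rpower_gt0 | exact: exp_pos]. }
      assert (I : t * (Rpower t x * exp (- t)) <= c).
      { rewrite -{1}(exp_ln t); last lra. rewrite /Rpower /c -!exp_plus.
        assert (H1 := mul_ln_le (x + 1) t ltac:(lra) ltac:(lra)).
        match goal with |- exp ?u <= exp ?v => destruct (Rle_lt_or_eq_dec u v) as [Hl|Heq] end.
        - lra.
        - apply Rlt_le. exact: exp_increasing.
        - rewrite Heq. lra. }
      apply (Rmult_lt_reg_l t); first lra.
      eapply Rle_lt_trans; first exact I.
      apply (Rmult_lt_compat_r eps) in Ht; last lra.
      replace (c / eps * eps) with c in Ht by (field; lra). lra. }
  assert (E2 : is_RInt_gen h (at_right 0) (Rbar_locally p_infty) (x * Gamma x - Gamma (x + 1))).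
  { apply: is_RInt_gen_minus; last exact G2. exact: is_RInt_gen_scal. }
  assert (U := is_RInt_gen_unique h (0 - 0) E).
  rewrite (is_RInt_gen_unique h (x * Gamma x - Gamma (x + 1)) E2) in U.
  change (@eq R (x * Gamma x - Gamma (x + 1)) (0 - 0)) in U. lra.
Qed.

(** Convexity of exp: its tangent at b = theta ln u, taken at ln u and at 0 and averaged with
    weights theta and 1 - theta, gives exactly exp b. *)
Lemma Rpower_le_tangent (theta u : R) : 0 <= theta <= 1 -> 0 < u ->
  Rpower u theta <= 1 - theta + theta * u.
Proof.
  intros Ht Hu. rewrite /Rpower.
  rewrite -{2}(exp_ln u) //. set a := ln u. set b := theta * a.
  assert (H1 := exp_ineq1_le (a - b)). assert (H2 := exp_ineq1_le (- b)).
  assert (E1 : exp b * exp (a - b) = exp a) by (rewrite -exp_plus; f_equal; ring).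
  assert (E2 : exp b * exp (- b) = 1) by (rewrite -exp_plus -exp_0; f_equal; ring).
  have Hb := exp_pos b.
  assert (I1 : exp b * (1 + (a - b)) <= exp a) by (rewrite -E1; apply Rmult_le_compat_l; lra).
  assert (I2 : exp b * (1 + - b) <= 1) by (rewrite -E2; apply Rmult_le_compat_l; lra).
  assert (I3 : theta * (exp b * (1 + (a - b))) <= theta * exp a) by (apply Rmult_le_compat_l; lra).
  assert (I4 : (1 - theta) * (exp b * (1 + - b)) <= (1 - theta) * 1) by (apply Rmult_le_compat_l; lra).
  replace (exp b) with (theta * (exp b * (1 + (a - b))) + (1 - theta) * (exp b * (1 + - b))); first lra.
  replace b with (theta * a) at 2 4 by reflexivity. ring.
Qed.

(* Integrate the tangent line inequality (t/z)^theta <= 1 - theta + theta t/z against t^(z-1) e^(-t). *)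
Lemma Gamma_add_le (z theta : R) : 0 < z -> 0 <= theta <= 1 ->
  Gamma (z + theta) <= Rpower z theta * Gamma z.
Proof.
  intros Hz Ht.
  destruct (Gamma_is_RInt_gen z Hz) as [G1 P1].
  destruct (Gamma_is_RInt_gen (z + 1) ltac:(lra)) as [G2 _].
  destruct (Gamma_is_RInt_gen (z + theta) ltac:(lra)) as [G3 P3].
  pose (g := fun t => Rpower z theta * ((1 - theta) * gamma_integrand z t +
     theta / z * gamma_integrand (z + 1) t)).
  assert (Hg : is_RInt_gen g (at_right 0) (Rbar_locally p_infty)
     (Rpower z theta * ((1 - theta) * Gamma z + theta / z * Gamma (z + 1)))).
  { apply: is_RInt_gen_scal.
    apply: (is_RInt_gen_plus (fun t => (1 - theta) * gamma_integrand z t)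
      (fun t => theta / z * gamma_integrand (z + 1) t)).
    - exact: is_RInt_gen_scal.
    - exact: is_RInt_gen_scal. }
  assert (I : norm (Gamma (z + theta)) <=
    Rpower z theta * ((1 - theta) * Gamma z + theta / z * Gamma (z + 1))).
  { apply (RInt_gen_norm (Fa := at_right 0) (Fb := Rbar_locally p_infty)
      (gamma_integrand (z + theta)) g); [| | exact G3 | exact Hg].
    - apply (filter_prod_0_infty 1 1); first lra. move=> x y Hx Hy /=. lra.
    - apply (filter_prod_0_infty 1 1); first lra. move=> x y Hx Hy t /= Htt.
      rewrite /norm /= /abs /= Rabs_pos_eq; last by apply Rlt_le, gamma_integrand_gt0.
      assert (Ht0 : 0 < t) by lra.
      assert (H := Rpower_le_tangent theta (t / z) Ht ltac:(exact: Rdiv_lt_0_compat)).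
      rewrite /g /gamma_integrand.
      replace (z + theta - 1) with (theta + (z - 1)) by ring.
      replace (z + 1 - 1) with (1 + (z - 1)) by ring.
      set r := z - 1.
      rewrite (Rpower_plus theta r) (Rpower_plus 1 r) Rpower_1 //.
      replace t with (z * (t / z)) at 1 by (field; lra).
      rewrite -Rpower_mult_distr //; last by exact: Rdiv_lt_0_compat.
      replace (Rpower z theta * ((1 - theta) * (Rpower t r * exp (- t)) +
        theta / z * (t * Rpower t r * exp (- t)))) with
        (Rpower z theta * (1 - theta + theta * (t / z)) * Rpower t r * exp (- t)) by (field; lra).
      apply Rmult_le_compat_r; first by apply Rlt_le, exp_pos.
      apply Rmult_le_compat_r; first by apply Rlt_le, Rpower_gt0.
      apply Rmult_le_compat_l; first by apply Rlt_le, Rpower_gt0. exact H. }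
  rewrite /norm /= /abs /= Rabs_pos_eq in I; last lra.
  rewrite Gamma_succ // in I.
  replace ((1 - theta) * Gamma z + theta / z * (z * Gamma z)) with (Gamma z) in I by (field; lra).
  exact I.
Qed.

(** The upper bound started at [z + theta] with exponent [1 - theta] ends at [Gamma (z + 1)]. *)
Lemma Gamma_add_ge (z theta : R) : 0 < z -> 0 <= theta <= 1 ->
  z * Gamma z <= Rpower (z + theta) (1 - theta) * Gamma (z + theta).
Proof.
  intros Hz Ht. rewrite -Gamma_succ //.
  replace (z + 1) with (z + theta + (1 - theta)) by ring.
  apply Gamma_add_le; lra.
Qed.

(** * The Beta integral *)

(** Euler's B(x+1, y+1): with the shifted exponents the integrand is continuous on [0, 1] for
    positive [x] and [y]. *)
Definition beta (x y : R) : R := RInt (fun s => rpow x (1 - s) * rpow y s) 0 1.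

Lemma rpow_a1 (a : R) : rpow a 1 = 1.
Proof. rewrite rpow_pos ?/Rpower ?ln_1 ?Rmult_0_r ?exp_0 //. lra. Qed.

Lemma rpow_succ (a t : R) : 0 <= t -> rpow (a + 1) t = rpow a t * t.
Proof. move=> Ht. rewrite rpow_plus rpow_1 //. Qed.

Lemma is_derive_rpow_succ (a t : R) : 0 < t -> is_derive (rpow (a + 1)) t ((a + 1) * rpow a t).
Proof.
  intros Ht. rewrite (rpow_pos a) //. replace a with (a + 1 - 1) at 3 by ring.
  exact: is_derive_rpow.
Qed.

Lemma is_derive_rpow_sub (a c t : R) : t < c ->
  is_derive (fun s => rpow (a + 1) (c - s)) t (- ((a + 1) * rpow a (c - t))).
Proof.
  intros Ht. replace (- ((a + 1) * rpow a (c - t))) with (scal (-1) ((a + 1) * rpow a (c - t)))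
    by (rewrite /scal /= /mult /=; ring).
  apply: (is_derive_comp (rpow (a + 1)) (fun s => c - s)).
  - apply: is_derive_rpow_succ. lra.
  - auto_derive => //.
Qed.

Lemma beta_ge0 (x y : R) : 0 < x -> 0 < y -> 0 <= beta x y.
Proof.
  intros Hx Hy.
  assert (cx : forall t, continuous (rpow x) t) by (move=> t; exact: continuous_rpow).
  assert (cy : forall t, continuous (rpow y) t) by (move=> t; exact: continuous_rpow).
  apply RInt_ge_0; [lra | exint |].
  move=> s _. apply Rmult_le_pos; exact: rpow_ge0.
Qed.

(** The function (1-s)^(x+1) s^(y+1) vanishes at both ends of [0, 1], and its derivative is (1-s)^x
    s^y ((y+1) - (x+y+2) s). *)
Lemma beta_succ (x y : R) : 0 < x -> 0 < y -> (x + y + 2) * beta x (y + 1) = (y + 1) * beta x y.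
Proof.
  intros Hx Hy.
  assert (cr : forall a t, 0 < a -> continuous (rpow a) t) by exact: continuous_rpow.
  assert (cx : forall t, continuous (rpow x) t) by (move=> t; exact: cr).
  assert (cy : forall t, continuous (rpow y) t) by (move=> t; exact: cr).
  assert (cx1 : forall t, continuous (rpow (x + 1)) t) by (move=> t; apply: cr; lra).
  assert (cy1 : forall t, continuous (rpow (y + 1)) t) by (move=> t; apply: cr; lra).
  apply Rminus_diag_uniq_sym.
  rewrite /beta -!RInt_mulR; try by exint.
  rewrite -RInt_subR; try by exint.
  rewrite (FTC_open (fun s => rpow (x + 1) (1 - s) * rpow (y + 1) s)); [| lra | | cont1 | cont1].
  - rewrite Rminus_diag !(rpow_nonpos _ 0); try lra.
  - move=> s Hs.
    replace ((y + 1) * (rpow x (1 - s) * rpow y s) - (x + y + 2) * (rpow x (1 - s) * rpow (y + 1) s))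
      with (- ((x + 1) * rpow x (1 - s)) * rpow (y + 1) s + rpow (x + 1) (1 - s) * ((y + 1) * rpow y s)).
    + apply: (is_derive_mult (fun s => rpow (x + 1) (1 - s)) (rpow (y + 1))).
      * apply is_derive_rpow_sub. lra.
      * apply is_derive_rpow_succ. lra.
      * move=> a b. exact: Rmult_comm.
    + rewrite (rpow_succ x); last lra. rewrite (rpow_succ y); last lra. ring.
Qed.

Lemma beta_antitone (x y z : R) : 0 < x -> 0 < y <= z -> beta x z <= beta x y.
Proof.
  intros Hx Hy.
  assert (cr : forall a, 0 < a -> forall t, continuous (rpow a) t)
    by (move=> a Ha t; exact: continuous_rpow).
  assert (cx := cr x Hx). assert (cy := cr y ltac:(lra)). assert (cz := cr z ltac:(lra)).
  apply RInt_le; [lra | exint | exint |].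
  move=> s Hs. apply Rmult_le_compat_l; first exact: rpow_ge0.
  replace z with (y + (z - y)) by ring. rewrite rpow_plus.
  assert (rpow (z - y) s <= 1).
  { rewrite -(rpow_a1 (z - y)). apply rpow_le; lra. }
  have := rpow_ge0 y s. nra.
Qed.

Lemma beta_1 (x : R) : 0 < x -> beta x 1 = / ((x + 1) * (x + 2)).
Proof.
  intros Hx.
  assert (cr : forall a, 0 < a -> forall t, continuous (rpow a) t)
    by (move=> a Ha t; exact: continuous_rpow).
  assert (cx := cr x Hx). assert (c1 := cr 1 ltac:(lra)).
  assert (cx1 := cr (x + 1) ltac:(lra)). assert (cx2 := cr (x + 1 + 1) ltac:(lra)).
  rewrite /beta (FTC_open (fun s => / (x + 1 + 1) * rpow (x + 1 + 1) (1 - s) -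
     / (x + 1) * rpow (x + 1) (1 - s))); [| lra | | cont1 | cont1].
  - rewrite Rminus_diag Rminus_0_r !rpow_a1 !(rpow_nonpos _ 0); try lra.
    change (@eq R (/ (x + 1 + 1) * 0 - / (x + 1) * 0 - (/ (x + 1 + 1) * 1 - / (x + 1) * 1))
      (/ ((x + 1) * (x + 2)))). field. lra.
  - move=> s Hs.
    replace (rpow x (1 - s) * rpow 1 s) with
      (minus (/ (x + 1 + 1) * - ((x + 1 + 1) * rpow (x + 1) (1 - s)))
         (/ (x + 1) * - ((x + 1) * rpow x (1 - s)))).
    + apply: is_derive_minus; apply: is_derive_scal; apply: is_derive_rpow_sub; lra.
    + rewrite rpow_1; last lra. rewrite rpow_succ; last lra.
      rewrite /minus /plus /opp /=. field. lra.
Qed.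

Section BetaGamma.

Variable x : R.
Hypothesis Hx : 0 < x.

(** The Beta formula says that this equals Gamma(x+1) for every [y]. *)
Let ratio (y : R) : R := beta x y * Gamma (x + y + 2) / Gamma (y + 1).

Let ratio_succ (y : R) : 0 < y -> ratio (y + 1) = ratio y.
Proof.
  intros Hy. rewrite /ratio.
  replace (x + (y + 1) + 2) with (x + y + 2 + 1) by ring.
  rewrite !Gamma_succ; try lra.
  have HG := Gamma_gt0 y Hy. have HB := beta_succ x y Hx Hy.
  replace (beta x (y + 1) * ((x + y + 2) * Gamma (x + y + 2)) / ((y + 1) * (y * Gamma y))) with
    ((x + y + 2) * beta x (y + 1) * Gamma (x + y + 2) / ((y + 1) * (y * Gamma y))) by (field; lra).
  rewrite HB. field. lra.
Qed.

Let ratio_add_nat (y : R) (n : nat) : 0 < y -> ratio (y + INR n) = ratio y.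
Proof.
  intros Hy. induction n as [|n IH]; first by rewrite /= Rplus_0_r.
  rewrite S_INR -Rplus_assoc ratio_succ //. have := pos_INR n. lra.
Qed.

(** Within one period the ratio varies by at most the factor (x+y+3)/(y+1), which tends to 1 as y
    grows. *)
Let ratio_add_bounds (y theta : R) : 0 < y -> 0 <= theta <= 1 ->
  (y + 1) * ratio (y + theta) <= (x + y + 3) * ratio y /\
  (y + 1) * ratio y <= (x + y + 3) * ratio (y + theta).
Proof.
  intros Hy Ht. rewrite /ratio.
  replace (x + (y + theta) + 2) with (x + y + 2 + theta) by ring.
  replace (y + theta + 1) with (y + 1 + theta) by ring.
  pose (z := x + y + 2). pose (v := y + 1).
  replace (x + y + 3) with (z + 1) by (rewrite /z; ring). rewrite -/z -/v.
  have P1 := Gamma_gt0 z ltac:(rewrite /z; lra).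
  have P2 := Gamma_gt0 (z + theta) ltac:(rewrite /z; lra).
  have P3 := Gamma_gt0 v ltac:(rewrite /v; lra).
  have P4 := Gamma_gt0 (v + theta) ltac:(rewrite /v; lra).
  have U1 := Gamma_add_le z theta ltac:(rewrite /z; lra) Ht.
  have L1 := Gamma_add_ge z theta ltac:(rewrite /z; lra) Ht.
  have U2 := Gamma_add_le v theta ltac:(rewrite /v; lra) Ht.
  have L2 := Gamma_add_ge v theta ltac:(rewrite /v; lra) Ht.
  have B0 := beta_ge0 x y Hx Hy. have B1 := beta_ge0 x (y + theta) Hx ltac:(lra).
  have B2 : beta x (y + theta) <= beta x y by apply beta_antitone; lra.
  (* Monotonicity gives beta(x, y+theta) >= beta(x, y+1), and the recursion expresses the latter
     through beta(x, y). *)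
  have B3 : v * beta x y <= z * beta x (y + theta).
  { rewrite /v -beta_succ // -/z. apply Rmult_le_compat_l; first (rewrite /z; lra).
    apply beta_antitone; lra. }
  (* The Gamma bounds leave one power with exponent theta and one with 1 - theta; all bases are at
     most z + 1, so together they contribute one factor z + 1. *)
  assert (Hpw : forall a b, 0 < a <= z + 1 -> 0 < b <= z + 1 ->
    Rpower a theta * Rpower b (1 - theta) <= z + 1).
  { move=> a b Hab Hb.
    replace (z + 1) with (Rpower (z + 1) theta * Rpower (z + 1) (1 - theta)).
    - apply Rmult_le_compat; try (apply Rlt_le, Rpower_gt0); apply Rle_Rpower_l; lra.
    - rewrite -Rpower_plus. replace (theta + (1 - theta)) with 1 by ring.
      apply Rpower_1. lra. }
  assert (Hdiv : forall a b c d, 0 < b -> 0 < d -> a * d <= c * b -> a / b <= c / d).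
  { move=> a b c d Hb Hd H. apply (Rmult_le_reg_r (b * d)); first nra.
    replace (a / b * (b * d)) with (a * d) by (field; lra).
    replace (c / d * (b * d)) with (c * b) by (field; lra). exact H. }
  have Z1 := Rpower_gt0 z theta. have Z2 := Rpower_gt0 v theta.
  have Z3 := Rpower_gt0 (z + theta) (1 - theta). have Z4 := Rpower_gt0 (v + theta) (1 - theta).
  split; rewrite !Rmult_div_assoc; apply Hdiv => //.
  - have H := Hpw z (v + theta) ltac:(rewrite /z; lra) ltac:(rewrite /z /v; lra).
    apply Rle_trans with (beta x y * (Rpower z theta * Gamma z) *
       (Rpower (v + theta) (1 - theta) * Gamma (v + theta))).
    + replace (v * (beta x (y + theta) * Gamma (z + theta)) * Gamma v) with
        (beta x (y + theta) * Gamma (z + theta) * (v * Gamma v)) by ring.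
      apply Rmult_le_compat => //.
      * apply Rmult_le_pos; lra.
      * apply Rmult_le_pos; [rewrite /v; lra | lra].
      * apply Rmult_le_compat; lra.
    + replace (beta x y * (Rpower z theta * Gamma z) * (Rpower (v + theta) (1 - theta) * Gamma (v + theta)))
        with (Rpower z theta * Rpower (v + theta) (1 - theta) * (beta x y * Gamma z * Gamma (v + theta))) by ring.
      replace ((z + 1) * (beta x y * Gamma z) * Gamma (v + theta))
        with ((z + 1) * (beta x y * Gamma z * Gamma (v + theta))) by ring.
      apply Rmult_le_compat_r => //. repeat apply Rmult_le_pos; lra.
  - have H := Hpw v (z + theta) ltac:(rewrite /z /v; lra) ltac:(rewrite /z; lra).
    apply Rle_trans with (beta x (y + theta) * (z * Gamma z) * (Rpower v theta * Gamma v)).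
    + replace (v * (beta x y * Gamma z) * Gamma (v + theta)) with
        (v * beta x y * Gamma z * Gamma (v + theta)) by ring.
      replace (beta x (y + theta) * (z * Gamma z)) with (z * beta x (y + theta) * Gamma z) by ring.
      apply Rmult_le_compat; try lra.
      * repeat apply Rmult_le_pos; try lra; rewrite /v; lra.
      * apply Rmult_le_compat_r; lra.
    + apply Rle_trans with (beta x (y + theta) * (Rpower (z + theta) (1 - theta) * Gamma (z + theta))
         * (Rpower v theta * Gamma v)).
      * apply Rmult_le_compat_r; first (apply Rmult_le_pos; lra).
        apply Rmult_le_compat_l; lra.
      * replace (beta x (y + theta) * (Rpower (z + theta) (1 - theta) * Gamma (z + theta))
         * (Rpower v theta * Gamma v)) with (Rpower v theta * Rpower (z + theta) (1 - theta) *
           (beta x (y + theta) * Gamma (z + theta) * Gamma v)) by ring.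
        replace ((z + 1) * (beta x (y + theta) * Gamma (z + theta)) * Gamma v)
          with ((z + 1) * (beta x (y + theta) * Gamma (z + theta) * Gamma v)) by ring.
        apply Rmult_le_compat_r => //. repeat apply Rmult_le_pos; lra.
Qed.

Let ratio_1 : ratio 1 = Gamma (x + 1).
Proof.
  rewrite /ratio beta_1 // !Gamma_succ; try lra. rewrite Gamma_1.
  replace (x + 1 + 2) with (x + 1 + 1 + 1) by ring.
  rewrite !Gamma_succ; try lra. field. lra.
Qed.

(* The ratio is 1-periodic in y and asymptotically constant, hence constant. *)
Lemma beta_Gamma (y : R) : 0 < y -> beta x y = Gamma (x + 1) * Gamma (y + 1) / Gamma (x + y + 2).
Proof.
  intros Hy.
  have P1 := Gamma_gt0 (y + 1) ltac:(lra).
  have P2 := Gamma_gt0 (x + y + 2) ltac:(lra).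
  enough (E : ratio y = ratio 1).
  { rewrite ratio_1 /ratio in E. rewrite -E. field. lra. }
  destruct (nfloor_ex y) as [n Hn]; first lra.
  (* The bounds at 1 + n + k with theta = y - n, reduced by periodicity to [ratio 1] and [ratio y].
     If these differed, k times their distance would stay bounded in k. *)
  assert (H : forall k : nat, INR k * ratio y <= (x + INR n + INR k + 4) * ratio 1 - (INR n + 2) * ratio y /\
     INR k * ratio 1 <= (x + INR n + INR k + 4) * ratio y - (INR n + 2) * ratio 1).
  { move=> k. have Hk := pos_INR k. have Hn0 := pos_INR n.
    have := ratio_add_bounds (1 + INR (n + k)) (y - INR n) ltac:(rewrite plus_INR; lra) ltac:(lra).
    rewrite (ratio_add_nat 1 (n + k)); last lra.
    replace (1 + INR (n + k) + (y - INR n)) with (y + INR (1 + k)) by (rewrite !plus_INR /=; ring).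
    rewrite ratio_add_nat // plus_INR. lra. }
  apply NNPP => Hne.
  assert (Hd : forall r, 0 < r -> forall c, exists k : nat, c < INR k * r).
  { move=> r Hr c. destruct (INR_unbounded (c / r)) as [k Hk]. exists k.
    apply Rgt_lt in Hk. apply (Rmult_lt_compat_r r) in Hk => //.
    replace (c / r * r) with c in Hk by (field; lra). exact Hk. }
  destruct (Rtotal_order (ratio y) (ratio 1)) as [Hlt|[Heq|Hgt]] => //.
  - destruct (Hd (ratio 1 - ratio y) ltac:(lra)
       ((x + INR n + 4) * ratio y - (INR n + 2) * ratio 1)) as [k Hk].
    have := H k. lra.
  - destruct (Hd (ratio y - ratio 1) ltac:(lra)
       ((x + INR n + 4) * ratio 1 - (INR n + 2) * ratio y)) as [k Hk].
    have := H k. lra.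
Qed.

End BetaGamma.

Lemma conv_rpow (x y t : R) : 0 < x -> 0 < y -> 0 <= t ->
  conv (rpow x) (rpow y) t =
    Gamma (x + 1) * Gamma (y + 1) / Gamma (x + y + 2) * rpow (x + y + 1) t.
Proof.
  intros Hx Hy Ht.
  assert (cx : forall t, continuous (rpow x) t) by (move=> s; exact: continuous_rpow).
  assert (cy : forall t, continuous (rpow y) t) by (move=> s; exact: continuous_rpow).
  rewrite -beta_Gamma // /beta /conv.
  transitivity (RInt (fun s => rpow x (t - s) * rpow y s) (t * 0 + 0) (t * 1 + 0)).
  { f_equal; ring. }
  rewrite -RInt_comp_lin; last by exint.
  rewrite Rmult_comm -RInt_mulR; last by exint.
  apply RInt_ext => s. rewrite Rmin_left ?Rmax_right; try lra. move=> Hs.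
  rewrite /scal /= /mult /= Rplus_0_r.
  replace (t - t * s) with (t * (1 - s)) by ring.
  rewrite !rpow_mult_distr ?rpow_succ ?rpow_plus; try lra.
Qed.

(** * The Mittag-Leffler function *)

Lemma sum_n_abs_tail (a : nat -> R) (z r : R) (N M : nat) :
  (forall n, 0 <= a n) -> Rabs z <= r -> (N <= M)%nat ->
  Rabs (sum_n (fun k => a k * z ^ k) M - sum_n (fun k => a k * z ^ k) N) <=
    sum_n (fun k => a k * r ^ k) M - sum_n (fun k => a k * r ^ k) N.
Proof.
  intros Ha Hz. induction 1 as [|M HM IH].
  - rewrite !Rminus_diag Rabs_R0. lra.
  - pose (f := fun k => a k * z ^ k). pose (g := fun k => a k * r ^ k).
    rewrite -/f -/g in IH |- *.
    assert (Ef : sum_n f (S M) = sum_n f M + f (S M)) by exact: sum_Sn.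
    assert (Eg : sum_n g (S M) = sum_n g M + g (S M)) by exact: sum_Sn.
    assert (I : Rabs (a (S M) * z ^ (S M)) <= a (S M) * r ^ (S M)).
    { rewrite Rabs_mult -RPow_abs Rabs_pos_eq //.
      apply Rmult_le_compat_l => //. apply pow_incr. split => //. exact: Rabs_pos. }
    rewrite Ef Eg.
    replace (sum_n f M + f (S M) - sum_n f N) with (sum_n f M - sum_n f N + f (S M)) by ring.
    eapply Rle_trans; first exact: Rabs_triang. rewrite -/(f (S M)) -/(g (S M)) in I. lra.
Qed.

Lemma is_lim_seq_PSeries (a : nat -> R) (z : R) : CV_radius a = p_infty ->
  is_lim_seq (sum_n (fun k => a k * z ^ k)) (PSeries a z).
Proof.
  intros Ha. assert (H : ex_pseries a z) by (apply CV_radius_inside; rewrite Ha //).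
  apply PSeries_correct in H. apply is_pseries_R in H. exact H.
Qed.

(** With nonnegative coefficients the tail at [r] dominates every tail with |z| <= r; this is the
    uniform convergence behind termwise integration. *)
Lemma PSeries_tail_le (a : nat -> R) (z r : R) (N : nat) : CV_radius a = p_infty ->
  (forall n, 0 <= a n) -> Rabs z <= r ->
  Rabs (PSeries a z - sum_n (fun k => a k * z ^ k) N) <=
    PSeries a r - sum_n (fun k => a k * r ^ k) N.
Proof.
  intros HR Ha Hz.
  apply (is_lim_seq_le_loc
    (fun M => Rabs (sum_n (fun k => a k * z ^ k) M - sum_n (fun k => a k * z ^ k) N))
    (fun M => sum_n (fun k => a k * r ^ k) M - sum_n (fun k => a k * r ^ k) N)
    (Finite (Rabs (PSeries a z - sum_n (fun k => a k * z ^ k) N)))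
    (Finite (PSeries a r - sum_n (fun k => a k * r ^ k) N))).
  - exists N => M HM. exact: sum_n_abs_tail.
  - apply (is_lim_seq_abs _ (Finite _)). apply: is_lim_seq_minus'; last exact: is_lim_seq_const.
    exact: is_lim_seq_PSeries.
  - apply: is_lim_seq_minus'; last exact: is_lim_seq_const.
    exact: is_lim_seq_PSeries.
Qed.

Section MittagLeffler.

Variables alpha lam : R.
Hypotheses (Ha : 0 < alpha < 1) (Hlam : 0 < lam).

Definition ml_coef (n : nat) : R := / Gamma (INR n * alpha + 1).

Let arg_gt0 (n : nat) : 0 < INR n * alpha + 1.
Proof. have := pos_INR n. nra. Qed.

Lemma ml_coef_gt0 (n : nat) : 0 < ml_coef n.
Proof. apply Rinv_0_lt_compat, Gamma_gt0, arg_gt0. Qed.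

(** Ratio test: for z = n alpha + 1 the lower Gamma bound gives Gamma(z)/Gamma(z+alpha) <=
    (z+alpha)^(1-alpha)/z <= 2 z^(-alpha), which tends to 0. *)
Lemma ml_coef_CV_radius : CV_radius ml_coef = p_infty.
Proof.
  apply CV_radius_infinite_DAlembert.
  { move=> n. have := ml_coef_gt0 n. lra. }
  apply is_lim_seq_spec => eps. have He := cond_pos eps.
  destruct (INR_unbounded (Rpower (2 / eps) (/ alpha) / alpha)) as [N HN].
  exists N => n Hn. apply le_INR in Hn.
  have Hc0 := ml_coef_gt0 n. have Hc1 := ml_coef_gt0 (S n).
  rewrite Rminus_0_r Rabs_Rabsolu Rabs_pos_eq; last by apply Rlt_le, Rdiv_lt_0_compat.
  rewrite /ml_coef S_INR.
  replace ((INR n + 1) * alpha + 1) with (INR n * alpha + 1 + alpha) by ring.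
  have Hz := arg_gt0 n.
  assert (Hzn : Rpower (2 / eps) (/ alpha) < INR n * alpha + 1).
  { assert (H : Rpower (2 / eps) (/ alpha) / alpha < INR n) by lra.
    apply (Rmult_lt_compat_r alpha) in H; last lra.
    replace (Rpower (2 / eps) (/ alpha) / alpha * alpha) with (Rpower (2 / eps) (/ alpha)) in H
      by (field; lra). lra. }
  assert (Hz1 : 1 <= INR n * alpha + 1) by (have := pos_INR n; nra).
  move: Hz Hzn Hz1. move: (INR n * alpha + 1) => z Hz Hzn Hz1.
  have P1 := Gamma_gt0 z Hz. have P2 := Gamma_gt0 (z + alpha) ltac:(lra).
  have G := Gamma_add_ge z alpha Hz ltac:(lra).
  assert (I1 : Rpower (z + alpha) (1 - alpha) <= 2 * Rpower z (1 - alpha)).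
  { apply Rle_trans with (Rpower (2 * z) (1 - alpha)).
    - apply Rle_Rpower_l; lra.
    - rewrite -Rpower_mult_distr //; last lra.
      apply Rmult_le_compat_r; first by apply Rlt_le, Rpower_gt0.
      rewrite -{2}(Rpower_1 2); last lra. apply Rle_Rpower; lra. }
  assert (I2 : 2 < eps * Rpower z alpha).
  { assert (H : Rpower (Rpower (2 / eps) (/ alpha)) alpha < Rpower z alpha).
    { apply Rlt_Rpower_l; first lra. split => //. exact: Rpower_gt0. }
    assert (0 < 2 / eps) by (apply Rdiv_lt_0_compat; lra).
    rewrite Rpower_mult Rinv_l in H; last lra. rewrite Rpower_1 // in H.
    apply (Rmult_lt_compat_l eps) in H => //.
    replace (eps * (2 / eps)) with 2 in H by (field; lra). exact H. }
  assert (E : Rpower z alpha * Rpower z (1 - alpha) = z).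
  { rewrite -Rpower_plus. replace (alpha + (1 - alpha)) with 1 by ring. by rewrite Rpower_1. }
  have P3 := Rpower_gt0 z (1 - alpha).
  assert (I3 : 2 * Rpower z (1 - alpha) < eps * z).
  { rewrite -{2}E. nra. }
  replace (/ Gamma (z + alpha) / / Gamma z) with (Gamma z / Gamma (z + alpha)) by (field; lra).
  apply (Rmult_lt_reg_r (z * Gamma (z + alpha))); first nra.
  replace (Gamma z / Gamma (z + alpha) * (z * Gamma (z + alpha))) with (z * Gamma z) by (field; lra).
  nra.
Qed.

(** The g of the overview. Through [rpow] it takes the value 1 for t <= 0 and is continuous on the
    whole line. *)
Definition ml_relax (t : R) : R := PSeries ml_coef (- lam * rpow alpha t).

Let is_derive_ml_series (z : R) : is_derive (PSeries ml_coef) z (PSeries (PS_derive ml_coef) z).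
Proof. apply: is_derive_PSeries. by rewrite ml_coef_CV_radius. Qed.

Lemma continuous_ml_relax (t : R) : continuous ml_relax t.
Proof.
  apply: (continuous_comp (fun t => - lam * rpow alpha t) (PSeries ml_coef)).
  - apply: continuous_mult; first by apply continuous_const. apply continuous_rpow. lra.
  - apply: is_derive_continuous. exact: is_derive_ml_series.
Qed.

Lemma ml_relax_0 : ml_relax 0 = 1.
Proof.
  rewrite /ml_relax rpow_nonpos; last lra.
  rewrite Rmult_0_r PSeries_0 /ml_coef Rmult_0_l Rplus_0_l Gamma_1. exact: Rinv_1.
Qed.

(** The factor n + 1 from differentiation cancels against Gamma((n+1) alpha + 1) = (n+1) alpha
    Gamma((n+1) alpha). *)
Lemma PS_derive_ml_coef (z : R) : alpha * PSeries (PS_derive ml_coef) z = mittag_leffler alpha alpha z.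
Proof.
  rewrite /PSeries /mittag_leffler -Series_scal_l. apply Series_ext => n.
  rewrite /PS_derive /ml_coef S_INR. have Hn := pos_INR n.
  have P := Gamma_gt0 (INR n * alpha + alpha) ltac:(nra).
  replace ((INR n + 1) * alpha + 1) with (INR n * alpha + alpha + 1) by ring.
  rewrite Gamma_succ; last nra. field. repeat split; nra.
Qed.

Lemma is_derive_ml_relax (t : R) : 0 < t -> is_derive ml_relax t (- lam * ml_kernel alpha lam t).
Proof.
  intros Ht.
  replace (- lam * ml_kernel alpha lam t) with
    (scal (- lam * (alpha * Rpower t (alpha - 1))) (PSeries (PS_derive ml_coef) (- lam * rpow alpha t))).
  - apply: (is_derive_comp (PSeries ml_coef) (fun t => - lam * rpow alpha t)).
    + exact: is_derive_ml_series.
    + apply: is_derive_scal. exact: is_derive_rpow.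
  - rewrite /ml_kernel -PS_derive_ml_coef rpow_pos // /scal /= /mult /=. ring.
Qed.

Let term (n : nat) (t : R) : R := ml_coef n * (- lam * rpow alpha t) ^ n.

Let cr (a : R) (H : 0 < a) t : continuous (rpow a) t.
Proof. exact: continuous_rpow. Qed.

Let cterm n t : continuous (term n) t.
Proof.
  apply: continuous_mult; first by apply continuous_const.
  apply: (continuous_comp (fun t => - lam * rpow alpha t) (fun z => z ^ n)).
  - apply: continuous_mult; first by apply continuous_const. apply cr. lra.
  - apply: ex_derive_continuous. by auto_derive.
Qed.

Lemma RInt_rpow (a t : R) : 0 < a -> 0 <= t -> RInt (rpow a) 0 t = rpow (a + 1) t / (a + 1).
Proof.
  intros Hpos Ht.
  rewrite (FTC_open (fun t => / (a + 1) * rpow (a + 1) t)) //.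
  - rewrite (rpow_nonpos _ 0); last lra. rewrite Rmult_0_r Rminus_0_r. exact: Rmult_comm.
  - move=> x Hx. replace (rpow a x) with (/ (a + 1) * ((a + 1) * rpow a x)) by (field; lra).
    apply: is_derive_scal. apply is_derive_rpow_succ. lra.
  - move=> x. apply: continuous_mult; first by apply continuous_const. apply cr. lra.
  - exact: cr.
Qed.

(** The exponent starts at 1: for t <= 0 the power with exponent 0 is 1 while [rpow 0 t] is 0. Hence
    the separate treatment of [term 0] below. *)
Let rpow_pow (n : nat) (t : R) : rpow alpha t ^ (S n) = rpow (INR (S n) * alpha) t.
Proof.
  induction n as [|n IH]; first by rewrite /= Rmult_1_l Rmult_1_r.
  rewrite -tech_pow_Rmult IH (S_INR (S n)) Rmult_plus_distr_r Rmult_1_l rpow_plus. ring.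
Qed.

Let RInt_term_succ (n : nat) (t : R) : 0 <= t -> RInt (term (S n)) 0 t =
  (- lam) ^ (S n) * / Gamma (INR (S n) * alpha + 2) * rpow (INR (S n) * alpha + 1) t.
Proof.
  intros Ht.
  have Hp : 0 < INR (S n) * alpha by (rewrite S_INR; have := pos_INR n; nra).
  rewrite -(RInt_ext (fun s => ml_coef (S n) * (- lam) ^ (S n) * rpow (INR (S n) * alpha) s)).
  - rewrite RInt_mulR; last by (apply: ex_RInt_cont => x; exact: cr).
    rewrite RInt_rpow // /ml_coef.
    replace (INR (S n) * alpha + 2) with (INR (S n) * alpha + 1 + 1) by ring.
    have P := Gamma_gt0 (INR (S n) * alpha + 1) ltac:(lra).
    rewrite (Gamma_succ (INR (S n) * alpha + 1)); last lra. rfield. lra.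
  - move=> s _. rewrite /term Rpow_mult_distr rpow_pow. rring.
Qed.

(** The kernel sends each term to minus the primitive of the next one, so partial sums telescope up
    to a shift of the index, and only the primitive t of the constant term survives. *)
Let conv_term (n : nat) (t : R) : 0 <= t ->
  lam / Gamma (alpha + 1) * conv (rpow alpha) (term n) t = - RInt (term (S n)) 0 t.
Proof.
  intros Ht. have P := Gamma_gt0 (alpha + 1) ltac:(lra).
  have cra : forall t, continuous (rpow alpha) t by (apply cr; lra).
  rewrite RInt_term_succ //. destruct n as [|n].
  - rewrite conv_comm // /conv.
    rewrite (RInt_ext _ (rpow alpha)).
    + rewrite RInt_rpow //; last lra. rewrite Rmult_1_l pow_1.
      replace (alpha + 2) with (alpha + 1 + 1) by ring.
      rewrite (Gamma_succ (alpha + 1)); last lra. field. lra.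
    + move=> s _. rewrite /term /ml_coef /= Rmult_0_l Rplus_0_l Gamma_1.
      change (@eq R (/ 1 * 1 * rpow alpha s) (rpow alpha s)). field.
  - have Hp : 0 < INR (S n) * alpha by (rewrite S_INR; have := pos_INR n; nra).
    have P1 := Gamma_gt0 (INR (S n) * alpha + 1) ltac:(lra).
    assert (E : conv (rpow alpha) (term (S n)) t =
      ml_coef (S n) * (- lam) ^ (S n) * conv (rpow alpha) (rpow (INR (S n) * alpha)) t).
    { rewrite /conv -RInt_mulR.
      - apply RInt_ext => s _. rewrite /term Rpow_mult_distr rpow_pow. rring.
      - have crn : forall t, continuous (rpow (INR (S n) * alpha)) t by apply cr.
        exint. }
    rewrite E conv_rpow //; last lra. rewrite /ml_coef (S_INR (S n)).
    replace ((INR (S n) + 1) * alpha + 2) with (alpha + INR (S n) * alpha + 2) by ring.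
    replace ((INR (S n) + 1) * alpha + 1) with (alpha + INR (S n) * alpha + 1) by ring.
    have P2 := Gamma_gt0 (alpha + INR (S n) * alpha + 2) ltac:(lra).
    rewrite -(tech_pow_Rmult _ (S n)). field. lra.
Qed.

Let psum (N : nat) (t : R) : R := sum_n (fun k => term k t) N.

Let cpsum N t : continuous (psum N) t.
Proof.
  induction N as [|N IH].
  - apply (continuous_ext (term 0)) => // s. by rewrite /psum sum_O.
  - apply (continuous_ext (fun s => psum N s + term (S N) s)).
    + move=> s. by rewrite /psum sum_Sn.
    + exact: continuous_plus.
Qed.

Let conv_psum (N : nat) (t : R) : 0 <= t ->
  lam / Gamma (alpha + 1) * conv (rpow alpha) (psum N) t = t - RInt (psum (S N)) 0 t.
Proof.
  intros Ht. have cra : forall t, continuous (rpow alpha) t by (apply cr; lra).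
  have Hsum : forall N, RInt (psum (S N)) 0 t = RInt (psum N) 0 t + RInt (term (S N)) 0 t.
  { move=> M. rewrite -RInt_addR; try by exint.
    apply RInt_ext => s _. by rewrite /psum sum_Sn. }
  induction N as [|N IH].
  - rewrite Hsum. replace (conv (rpow alpha) (psum 0) t) with (conv (rpow alpha) (term 0) t).
    + rewrite conv_term // (RInt_ext (psum 0) (fun _ => 1)).
      * rewrite RInt_const /scal /= /mult /=. ring.
      * move=> s _. rewrite /psum sum_O /term /ml_coef /= Rmult_0_l Rplus_0_l Gamma_1.
        change (@eq R (/ 1 * 1) 1). field.
    + apply RInt_ext => s _. by rewrite /psum sum_O.
  - rewrite Hsum.
    replace (conv (rpow alpha) (psum (S N)) t) with
      (conv (rpow alpha) (psum N) t + 1 * conv (rpow alpha) (term (S N)) t).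
    + rewrite Rmult_1_l Rmult_plus_distr_l IH conv_term //. ring.
    + rewrite -conv_linear_r //. apply RInt_ext => s _.
      rewrite /psum sum_Sn /plus /=. rring.
Qed.

(* Termwise, this is the Beta integral for t^alpha and t^(n alpha). *)
Lemma conv_rpow_ml_relax (t : R) : 0 <= t ->
  lam / Gamma (alpha + 1) * conv (rpow alpha) ml_relax t = t - RInt ml_relax 0 t.
Proof.
  intros Ht. have P := Gamma_gt0 (alpha + 1) ltac:(lra).
  have cra : forall t, continuous (rpow alpha) t by (apply cr; lra).
  have cg := continuous_ml_relax.
  pose (r := lam * rpow alpha t).
  (* The tail at r = lam t^alpha bounds the truncation error of [ml_relax] uniformly on [0, t]. *)
  pose (e := fun N => PSeries ml_coef r - sum_n (fun k => ml_coef k * r ^ k) N).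
  assert (He : is_lim_seq e 0).
  { replace 0 with (PSeries ml_coef r - PSeries ml_coef r) by ring.
    apply: is_lim_seq_minus'; first exact: is_lim_seq_const.
    apply is_lim_seq_PSeries, ml_coef_CV_radius. }
  assert (Hb : forall N s, 0 <= s <= t -> Rabs (ml_relax s - psum N s) <= e N).
  { move=> N s Hs. apply PSeries_tail_le; first exact: ml_coef_CV_radius.
    - move=> n. apply Rlt_le, ml_coef_gt0.
    - have H0 := rpow_ge0 alpha s. have H1 := rpow_le alpha s t ltac:(lra) ltac:(lra).
      rewrite Rabs_mult Rabs_Ropp !Rabs_pos_eq //; last lra.
      apply Rmult_le_compat_l; lra. }
  pose (c := lam / Gamma (alpha + 1)).
  assert (Hc : 0 < c) by exact: Rdiv_lt_0_compat.
  pose (D := c * conv (rpow alpha) ml_relax t - (t - RInt ml_relax 0 t)).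
  (* The identity is exact for partial sums, so the defect [D] consists of truncation errors only,
     of index N under the convolution and N + 1 under the plain integral. *)
  assert (HD : forall N, Rabs D <= c * (t * (rpow alpha t * e N)) + t * e (S N)).
  { move=> N.
    replace D with (c * (conv (rpow alpha) ml_relax t - conv (rpow alpha) (psum N) t) +
      (RInt ml_relax 0 t - RInt (psum (S N)) 0 t)).
    2:{ have := conv_psum N t Ht. rewrite -/c /D. lra. }
    eapply Rle_trans; first exact: Rabs_triang.
    apply Rplus_le_compat.
    - rewrite Rabs_mult (Rabs_pos_eq c); last lra.
      apply Rmult_le_compat_l; first lra.
      rewrite /conv -RInt_subR; try by exint.
      replace (t * (rpow alpha t * e N)) with ((t - 0) * (rpow alpha t * e N)) by ring.
      apply abs_RInt_le_const => //; first by exint.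
      move=> s Hs.
      replace (rpow alpha (t - s) * ml_relax s - rpow alpha (t - s) * psum N s) with
        (rpow alpha (t - s) * (ml_relax s - psum N s)) by ring.
      rewrite Rabs_mult (Rabs_pos_eq (rpow _ _)); last exact: rpow_ge0.
      apply Rmult_le_compat; [exact: rpow_ge0 | exact: Rabs_pos | apply rpow_le; lra | exact: Hb].
    - rewrite -RInt_subR; try by exint.
      replace (t * e (S N)) with ((t - 0) * e (S N)) by ring.
      apply abs_RInt_le_const => //; first by exint.
      move=> s Hs. exact: Hb. }
  assert (H0 : Rbar_le (Finite (Rabs D)) (Finite (c * (t * (rpow alpha t * 0)) + t * 0))).
  { apply (is_lim_seq_le (fun _ => Rabs D) (fun N => c * (t * (rpow alpha t * e N)) + t * e (S N))) => //.
    - exact: is_lim_seq_const.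
    - apply: is_lim_seq_plus'.
      + do 3 apply (is_lim_seq_scal_l _ _ (Finite _)). exact He.
      + apply (is_lim_seq_scal_l _ _ (Finite _)). by apply (is_lim_seq_incr_1 e). }
  simpl in H0. rewrite !Rmult_0_r Rplus_0_r in H0.
  have := Rabs_pos D => HD0. apply Rminus_diag_uniq. rewrite -/c -/D.
  destruct (Req_dec D 0) as [->|Hne] => //. have := Rabs_pos_lt D Hne. lra.
Qed.

End MittagLeffler.

(** * The memory term and the energy estimate *)

Lemma continuous_ml_kernel (alpha lam t : R) : 0 < alpha < 1 -> 0 < t ->
  continuous (ml_kernel alpha lam) t.
Proof.
  intros Ha Ht.
  have dR : forall a, is_derive (fun t => Rpower t a) t (a * Rpower t (a - 1)).
  { move=> a. exact: is_derive_Rpower. }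
  apply: continuous_mult; first by (apply: is_derive_continuous; exact: dR).
  apply: (continuous_comp (fun t => - lam * Rpower t alpha) (mittag_leffler alpha alpha)).
  - apply: continuous_mult; first by apply continuous_const.
    apply: is_derive_continuous. exact: dR.
  - apply (continuous_ext (fun z => alpha * PSeries (PS_derive (ml_coef alpha)) z)).
    + exact: PS_derive_ml_coef.
    + apply: continuous_mult; first by apply continuous_const.
      apply continuity_pt_filterlim. apply PSeries_continuity.
      by rewrite CV_radius_derive ml_coef_CV_radius.
Qed.

(** The memory integral is improper because the kernel is singular at s = t; continuity of the
    antiderivative up to the endpoints supplies its value. *)
Lemma is_RInt_gen_derive_open (F f : R -> R) (a b : R) : a < b ->
  (forall t, a < t < b -> is_derive F t (f t)) -> (forall t, a < t < b -> continuous f t) ->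
  continuous F a -> continuous F b ->
  is_RInt_gen f (at_right a) (at_left b) (F b - F a).
Proof.
  intros Hab dF cf ca cb.
  assert (Hprod : forall Q : R * R -> Prop,
    (forall x y, a < x < (a + b) / 2 -> (a + b) / 2 < y < b -> Q (x, y)) ->
    filter_prod (at_right a) (at_left b) Q).
  { move=> Q H. assert (Hm : 0 < (b - a) / 2) by lra.
    apply (Filter_prod _ _ _ (fun x => a < x < (a + b) / 2) (fun y => (a + b) / 2 < y < b)) => //.
    - exists (mkposreal _ Hm) => x. rewrite /ball /= /AbsRing_ball /abs /minus /plus /opp /= => Hx Hx0.
      apply Rabs_def2 in Hx. lra.
    - exists (mkposreal _ Hm) => x. rewrite /ball /= /AbsRing_ball /abs /minus /plus /opp /= => Hx Hx0.
      apply Rabs_def2 in Hx. lra. }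
  assert (HD : forall t, a < t < b -> Derive F t = f t).
  { move=> t Ht. apply is_derive_unique. exact: dF. }
  apply: (is_RInt_gen_ext (Derive F)).
  - apply Hprod => x y Hx Hy t /=. rewrite Rmin_left ?Rmax_right; try lra. move=> Ht.
    apply HD. lra.
  - apply: is_RInt_gen_Derive.
    + apply Hprod => x y Hx Hy t /=. rewrite Rmin_left ?Rmax_right; try lra. move=> Ht.
      exists (f t). apply dF. lra.
    + apply Hprod => x y Hx Hy t /=. rewrite Rmin_left ?Rmax_right; try lra. move=> Ht.
      apply (continuous_ext_loc _ f); last by apply cf; lra.
      assert (Hr : 0 < Rmin (t - a) (b - t)) by (apply Rmin_pos; lra).
      exists (mkposreal _ Hr) => z.
      rewrite /ball /= /AbsRing_ball /abs /minus /plus /opp /= => Hz.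
      apply Rabs_def2 in Hz. symmetry. apply HD.
      have := Rmin_l (t - a) (b - t). have := Rmin_r (t - a) (b - t). lra.
    + apply: filterlim_filter_le_1; last exact ca. exact: filter_le_within.
    + apply: filterlim_filter_le_1; last exact cb. exact: filter_le_within.
Qed.

(* Integration by parts: the kernel is -1/lam times the derivative of E_alpha(-lam t^alpha). *)
Lemma is_RInt_gen_ml_kernel (alpha lam t : R) (p q : R -> R) :
  0 < alpha < 1 -> 0 < lam -> 0 < t ->
  (forall x, continuous p x) -> (forall x, continuous q x) ->
  (forall s, 0 < s < t -> is_derive q s (p s)) -> q 0 = 0 ->
  is_RInt_gen (fun s => ml_kernel alpha lam (t - s) * q s) (at_right 0) (at_left t)
    (/ lam * (q t - conv (ml_relax alpha lam) p t)).
Proof.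
  intros Ha Hlam Ht cp cq dq q0.
  pose (g := ml_relax alpha lam).
  have cg : forall x, continuous g x by exact: continuous_ml_relax.
  pose (V := (fun x => RInt (fun s => g (t - s) * p s) 0 x) : R -> R).
  assert (cgp : forall x, continuous (fun s => g (t - s) * p s) x) by cont1.
  assert (dV : forall x, is_derive V x (g (t - x) * p x)) by (move=> x; exact: is_derive_primitive).
  assert (V0 : V 0 = 0) by (rewrite /V RInt_point //).
  assert (Vt : conv g p t = V t) by done.
  assert (cV : forall x, continuous V x) by (move=> x; exact: is_derive_continuous).
  clearbody V.
  (* Antiderivative of the memory integrand: differentiating g(t-s) q(s) yields lam times the
     integrand plus g(t-s) p(s), and [V] cancels the second part. *)
  pose (U := fun s => / lam * (g (t - s) * q s - V s)).
  assert (cU : forall x, continuous U x) by (rewrite /U; cont1).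
  rewrite -/g. replace (/ lam * (q t - conv g p t)) with (U t - U 0); last first.
  { rewrite /U Rminus_diag q0 V0 Vt /g ml_relax_0 //. ring. }
  apply is_RInt_gen_derive_open => //.
  - move=> s Hs.
    assert (D1 := is_derive_ml_relax alpha lam Ha (t - s) ltac:(lra)). rewrite -/g in D1.
    assert (D2 := dq s Hs). assert (D3 := dV s).
    rewrite /U. auto_derive.
    + repeat split; eexists; eassumption.
    + rewrite -?/(Rminus _ _) (is_derive_unique (fun x => g x) _ _ D1)
        (is_derive_unique (fun x => q x) _ _ D2) (is_derive_unique (fun x => V x) _ _ D3).
      field. lra.
  - move=> s Hs. apply: continuous_mult; last by apply cq.
    apply: (continuous_comp (fun s => t - s) (ml_kernel alpha lam)); first by cont1.
    apply continuous_ml_kernel => //. lra.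
Qed.

(** * Continuation of functions from [0, T] to the real line *)

Definition clamp (T x : R) : R := Rmax 0 (Rmin x T).

Lemma clamp_id (T x : R) : 0 <= x <= T -> clamp T x = x.
Proof. move=> Hx. rewrite /clamp Rmin_left ?Rmax_right; lra. Qed.

Lemma clamp_bounds (T x : R) : 0 <= T -> 0 <= clamp T x <= T.
Proof.
  move=> HT. rewrite /clamp. split; first exact: Rmax_l.
  apply Rmax_lub => //. exact: Rmin_r.
Qed.

Lemma clamp_lipschitz (T x y : R) : Rabs (clamp T y - clamp T x) <= Rabs (y - x).
Proof.
  rewrite /clamp /Rmax /Rmin /Rabs.
  repeat match goal with |- context [Rle_dec ?a ?b] => lazymatch a with context [Rle_dec] => fail | _ =>
    lazymatch b with context [Rle_dec] => fail | _ => destruct (Rle_dec a b) end end end;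
  repeat destruct Rcase_abs; lra.
Qed.

(** The clamp is a Lipschitz retraction onto [0, T], so continuity relative to the interval becomes
    the global continuity assumed for convolutions. *)
Lemma continuous_clamp_ext (T : R) (f : R -> R) : 0 <= T ->
  (forall t, 0 <= t <= T ->
     filterlim f (within (fun x => 0 <= x <= T) (locally t)) (locally (f t))) ->
  forall x, continuous (fun x => f (clamp T x)) x.
Proof.
  intros HT Hf x.
  apply: filterlim_comp; last by apply Hf; exact: clamp_bounds.
  move=> P [eps HP]. exists eps => y Hy. apply HP; last exact: clamp_bounds.
  eapply Rle_lt_trans; [exact: clamp_lipschitz | exact Hy].
Qed.

Lemma is_derive_clamp_ext (T t l : R) (f : R -> R) : 0 < t < T ->
  is_derive f t l -> is_derive (fun x => f (clamp T x)) t l.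
Proof.
  intros Ht. apply is_derive_ext_loc.
  assert (Hr : 0 < Rmin t (T - t)) by (apply Rmin_pos; lra).
  exists (mkposreal _ Hr) => y.
  rewrite /ball /= /AbsRing_ball /abs /minus /plus /opp /= => Hy. apply Rabs_def2 in Hy.
  have := Rmin_l t (T - t). have := Rmin_r t (T - t) => ? ?.
  rewrite clamp_id //. lra.
Qed.

Theorem theorem3p1 (T alpha c d lam u0 u1 : R) (p q : R -> R) :
  0 < T -> 0 < alpha < 1 -> 0 < c -> 0 < d -> 0 < lam ->
  (* p and q are continuous on [0, T] (one-sided at the endpoints) *)
  (forall t, 0 <= t <= T ->
     filterlim p (within (fun x => 0 <= x <= T) (locally t)) (locally (p t))) ->
  (forall t, 0 <= t <= T ->
     filterlim q (within (fun x => 0 <= x <= T) (locally t)) (locally (q t))) ->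
  (* q' = p on (0, T) *)
  (forall t, 0 < t < T -> is_derive q t (p t)) ->
  (* p'(t) + c q(t) = d \int_0^t e_{a,a}(-lam (t-s)^a) q(s) ds on (0, T) *)
  (forall t, 0 < t < T ->
     exists dp I : R,
       is_derive p t dp /\
       is_RInt_gen (fun s => ml_kernel alpha lam (t - s) * q s)
                   (at_right 0) (at_left t) I /\
       dp + c * q t = d * I) ->
  q 0 = u0 -> p 0 = u1 ->
  u0 = 0 -> 0 <= c - d / lam ->
  forall t, 0 <= t <= T -> (p t) ^ 2 + (c - d / lam) * (q t) ^ 2 <= u1 ^ 2.
Proof.
  intros HT Ha Hc Hd Hlam cp cq dq dp q0 p0 Hu0 Hmu t Ht.
  rewrite Hu0 in q0.
  pose (mu := c - d / lam). rewrite -/mu.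
  pose (g := ml_relax alpha lam).
  have cg : forall x, continuous g x by exact: continuous_ml_relax.
  pose (ph := fun x => p (clamp T x)). pose (qh := fun x => q (clamp T x)).
  have cph : forall x, continuous ph x by (apply continuous_clamp_ext => //; lra).
  have cqh : forall x, continuous qh x by (apply continuous_clamp_ext => //; lra).
  have ph_id : forall x, 0 <= x <= T -> ph x = p x by (move=> x Hx; rewrite /ph clamp_id).
  have qh_id : forall x, 0 <= x <= T -> qh x = q x by (move=> x Hx; rewrite /qh clamp_id).
  have dqh : forall x, 0 < x < T -> is_derive qh x (ph x).
  { move=> x Hx. apply is_derive_clamp_ext => //. rewrite ph_id; last lra. exact: dq. }
  have cW := conv_continuous g ph cg cph.
  pose (f := fun x => - mu * qh x - d / lam * conv g ph x).
  have cf : forall x, continuous f x by (rewrite /f; cont1).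
  have dph : forall x, 0 < x < T -> is_derive ph x (f x).
  { move=> x Hx. apply is_derive_clamp_ext => //.
    destruct (dp x Hx) as [dpx [I [Hdp [HI Heq]]]].
    replace (f x) with dpx => //.
    assert (HI' : is_RInt_gen (fun s => ml_kernel alpha lam (x - s) * q s) (at_right 0) (at_left x)
      (/ lam * (qh x - conv g ph x))).
    { have E : is_RInt_gen (fun s => ml_kernel alpha lam (x - s) * qh s) (at_right 0) (at_left x)
      (/ lam * (qh x - conv g ph x)).
      { apply is_RInt_gen_ml_kernel => //; try lra.
        - move=> s Hs. apply dqh. lra.
        - rewrite qh_id //. lra. }
      apply: is_RInt_gen_ext; last exact E.
      apply (Filter_prod _ _ _ (fun y => 0 < y < x) (fun y => 0 < y < x)).
      - apply (at_right_0_intro x) => //. lra.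
      - assert (Hx0 : 0 < x) by lra. exists (mkposreal x Hx0) => y.
        rewrite /ball /= /AbsRing_ball /abs /minus /plus /opp /= => Hy Hyx.
        apply Rabs_def2 in Hy. lra.
      - move=> y z Hy Hz s /= Hs. rewrite qh_id //.
        move: Hs. rewrite /Rmin /Rmax. case: Rle_dec => ?; lra. }
    (* The equation supplies some value [I]; uniqueness identifies it with the one found by
       parts. *)
    assert (U1 := is_RInt_gen_unique (fun s => ml_kernel alpha lam (x - s) * q s) _ HI).
    assert (U2 := is_RInt_gen_unique (fun s => ml_kernel alpha lam (x - s) * q s) _ HI').
    assert (EI : I = / lam * (qh x - conv g ph x)) by (rewrite -U1; exact U2).
    rewrite /f /mu. rewrite EI -(qh_id x) in Heq; last lra.
    replace dpx with (d * (/ lam * (qh x - conv g ph x)) - c * qh x) by lra.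
    field. lra. }
  (* [ph] may have corners at 0 and [T]. The primitive [P] agrees with it on [0, T] and is
     differentiable at every real point, as [conv_positive_type] requires; [Q] does the same for
     [qh]. *)
  pose (P := (fun x => u1 + RInt f 0 x) : R -> R).
  have dP : forall x, is_derive P x (f x).
  { move=> x. rewrite -(Rplus_0_l (f x)). apply: is_derive_plus; first exact: is_derive_const.
    exact: is_derive_primitive. }
  have cP : forall x, continuous P x by (move=> x; exact: is_derive_continuous).
  have P_id : forall x, 0 <= x <= T -> P x = ph x.
  { move=> x Hx. rewrite /P (FTC_open ph f); try lra.
    - rewrite (ph_id 0) ?p0; [ring | lra].
    - move=> y Hy. apply dph. lra.
    - exact cph.
    - exact cf. }
  have P0 : P 0 = u1 by rewrite /P RInt_point /zero /= Rplus_0_r.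
  pose (Q := (fun x => RInt P 0 x) : R -> R).
  have dQ : forall x, is_derive Q x (P x) by (move=> x; exact: is_derive_primitive).
  have cQ : forall x, continuous Q x by (move=> x; exact: is_derive_continuous).
  have Q0 : Q 0 = 0 by rewrite /Q RInt_point.
  have Q_id : forall x, 0 <= x <= T -> Q x = qh x.
  { move=> x Hx. rewrite /Q (FTC_open qh P); try lra.
    - rewrite (qh_id 0) ?q0; [ring | lra].
    - move=> y Hy. rewrite P_id; last lra. apply dqh. lra.
    - exact cqh.
    - exact cP. }
  have f_eq : forall x, 0 <= x <= T -> f x = - mu * Q x - d / lam * conv g P x.
  { move=> x Hx. rewrite /f Q_id //. f_equal. f_equal.
    apply RInt_ext => s. rewrite Rmin_left ?Rmax_right; try lra. move=> Hs.
    rewrite P_id //. lra. }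
  have cgP := conv_continuous g P cg cP.
  have Pos : 0 <= RInt (fun s => P s * conv g P s) 0 t.
  { have HG := Gamma_gt0 (alpha + 1) ltac:(lra).
    (* The constant is that of the integrated kernel: a primitive of (lam/Gamma(alpha)) t^(alpha-1)
       is (lam/Gamma(alpha+1)) t^alpha. *)
    apply (conv_positive_type alpha (lam / Gamma (alpha + 1)) t g P f) => //; try lra.
    - exact: Rdiv_lt_0_compat.
    - move=> s Hs. exact: conv_rpow_ml_relax. }
  have En : RInt (fun s => 2 * (P s * f s) + 2 * mu * (Q s * P s)) 0 t =
    P t ^ 2 + mu * Q t ^ 2 - u1 ^ 2.
  { rewrite (FTC_open (fun s => P s * P s + mu * (Q s * Q s))); [| lra | | cont1 | cont1].
    - rewrite Q0 P0. rring.
    - move=> s _. assert (D1 := dP s). assert (D2 := dQ s).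
      auto_derive.
      + repeat split; eexists; eassumption.
      + rewrite (is_derive_unique (fun x => P x) _ _ D1) (is_derive_unique (fun x => Q x) _ _ D2).
        ring. }
  (* Inserting the equation for [f] cancels the [mu] terms, so the energy changes by a nonpositive
     multiple of the integral in [Pos]. *)
  have En2 : RInt (fun s => 2 * (P s * f s) + 2 * mu * (Q s * P s)) 0 t =
    - (2 * (d / lam)) * RInt (fun s => P s * conv g P s) 0 t.
  { rewrite -RInt_mulR; last by exint.
    apply RInt_ext => s. rewrite Rmin_left ?Rmax_right; try lra. move=> Hs.
    rewrite f_eq; last lra. rring. }
  have Hdl : 0 < d / lam by apply Rdiv_lt_0_compat.
  rewrite -(qh_id t) // -(ph_id t) // -P_id // -Q_id //.
  rewrite En2 in En. nra.
Qed.
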